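(* Let $\mathbb{D}$ be a double category with lax products. Suppose given, in $\mathbb{F}\mathsf{am}^*(\mathbb{D})$, a proarrow $(B,\underline{n})\colon(K,\underline{w})\nrightarrow(L,\underline{z})$ and arrows $(f_0,f)\colon(I,\underline{x})\to(K,\underline{w})$ and $(g_0,g)\colon(J,\underline{y})\to(L,\underline{z})$ such that, for each $b\colon k\nrightarrow l$ in $B\colon K\nrightarrow L$, the proarrow $n_b\colon w_k\nrightarrow z_l$ has a restriction in $\mathbb{D}$ along $f_k\colon x_{f_0(k)}\to w_k$ and $g_l\colon y_{g_0(l)}\to z_l$, denoted $n_b(f_k,g_l)\colon x_{f_0(k)}\nrightarrow y_{g_0(l)}$. Then $\mathbb{D}$ has a restriction cell of the form $$\mathrm{res}\colon\Pi(\underline{n}(f,g))\to\Pi\underline{n}\quad\text{over}\quad\big(\Pi(f_0,f)\colon\Pi\underline{x}\to\Pi\underline{w},\ \Pi(g_0,g)\colon\Pi\underline{y}\to\Pi\underline{z}\big),$$ where $\Pi(\underline{n}(f,g))\colon\Pi\underline{x}\nrightarrow\Pi\underline{y}$ is the product of the proarrow family $(B,\underline{n}(f,g))\colon(I,\underline{x})\nrightarrow(J,\underline{y})$ indexed by the span $I\xleftarrow{f_0}K\leftarrow B\to L\xrightarrow{g_0}J$ and comprising the restricted proarrows $n_b(f_k,g_l)\colon x_{f_0(k)}\nrightarrow y_{g_0(l)}$ for each $b\colon k\nrightarrow l$.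
   Context: Double categories and double functors are pseudo unless otherwise stated. A proarrow is written $m\colon x\nrightarrow y$; a cell $\alpha\colon m\to n$ over $(f,g)$ has left side $f$ and right side $g$. For a span of sets $I\xleftarrow{\ell}A\xrightarrow{r}J$, written $A\colon I\nrightarrow J$, the notation $a\colon i\nrightarrow j$ means $a\in A$, $\ell(a)=i$, $r(a)=j$. A restriction of a proarrow $n\colon w\nrightarrow z$ along arrows $f\colon x\to w$ and $g\colon y\to z$ is a proarrow $p\colon x\nrightarrow y$ and a cell (restriction cell, also called cartesian cell) $\mathrm{res}\colon p\to n$ over $(f,g)$ such that every cell $m\to n$ over $(f\circ h,g\circ k)$ factors uniquely as $\mathrm{res}\circ\alpha$ with $\alpha\colon m\to p$ over $(h,k)$. The contravariant double category of families $\mathbb{F}\mathsf{am}^*(\mathbb{D})$ has: - objects $(I,\underline{x})$: a set $I$ and objects $x_i$ of $\mathbb{D}$, $i\in I$; - arrows $(f_0,f)\colon(I,\underline{x})\to(J,\underline{y})$: a function $f_0\colon J\to I$ and arrows $f_j\colon x_{f_0(j)}\to y_j$, $j\in J$; - proarrows $(A,\underline{m})\colon(I,\underline{x})\nrightarrow(J,\underline{y})$: a span of sets $A\colon I\nrightarrow J$ and proarrows $m_a\colon x_i\nrightarrow y_j$ for each $a\colon i\nrightarrow j$; - cells from $(A,\underline{m})\colon(I,\underline{x})\nrightarrow(J,\underline{y})$ to $(B,\underline{n})\colon(K,\underline{w})\nrightarrow(L,\underline{z})$ over $((f_0,f),(g_0,g))$: a map of spans $(f_0,\alpha_0,g_0)$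 from $B$ to $A$ and cells $\alpha_b\colon m_{\alpha_0(b)}\to n_b$ over $(f_k,g_l)$ for each $b\colon k\nrightarrow l$. External composition is by pullback of indexing spans and $(\underline{m}\odot\underline{n})_{(a,b)}=m_a\odot n_b$. $\mathbb{D}$ has lax products if the double functor $\Delta\colon\mathbb{D}\to\mathbb{F}\mathsf{am}^*(\mathbb{D})$ sending objects and proarrows to singleton families has a right adjoint $\Pi\colon\mathbb{F}\mathsf{am}^*(\mathbb{D})\to\mathbb{D}$ in the 2-category of double categories, lax double functors, and natural transformations. *)

(* Defs.v *)
From Stdlib Require Import FunctionalExtensionality ProofIrrelevance.
From Stdlib.Program Require Import Equality.

(** Equality of two elements of [P a b] and [P a' b'] lying over equalities
    [a = a'] and [b = b'].  Composition of arrows is only propositionally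
    associative and unital, so this is the equality used to compare cells with
    fixed source and target proarrows but different expressions for their left
    and right sides. *)
Inductive eq_over {A B : Type} (P : A -> B -> Type) {a : A} {b : B} (u : P a b) :
  forall {a' : A} {b' : B}, P a' b' -> Prop :=
| eq_over_refl : eq_over P u u.

Set Implicit Arguments.
Unset Strict Implicit.
Unset Printing Implicit Defensive.

Lemma eq_over_eq {A B : Type} (P : A -> B -> Type) {a : A} {b : B} (u v : P a b) :
  eq_over P u v -> u = v.
Proof. intros H; dependent destruction H; reflexivity. Qed.

(** [comp g f] and [ccomp beta alpha] are in the order of [g ∘ f]; external
    composition [odot m n] is in diagrammatic order, as in [m ⊙ n]. *)
Record DoubleCategory := {
  Ob : Type;
  Arr : Ob -> Ob -> Type;
  idA : forall x, Arr x x;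
  comp : forall {x y z}, Arr y z -> Arr x y -> Arr x z;
  comp_idl : forall {x y} (f : Arr x y), comp (idA y) f = f;
  comp_idr : forall {x y} (f : Arr x y), comp f (idA x) = f;
  comp_assoc : forall {x y z t} (h : Arr z t) (g : Arr y z) (f : Arr x y),
    comp h (comp g f) = comp (comp h g) f;

  Pro : Ob -> Ob -> Type;
  Cell : forall {x y w z}, Pro x y -> Pro w z -> Arr x w -> Arr y z -> Type;
  idC : forall {x y} (m : Pro x y), Cell m m (idA x) (idA y);
  ccomp : forall {x y w z u v} {m : Pro x y} {n : Pro w z} {p : Pro u v}
    {f : Arr x w} {g : Arr y z} {h : Arr w u} {k : Arr z v},
    Cell n p h k -> Cell m n f g -> Cell m p (comp h f) (comp k g);
  ccomp_idl : forall {x y w z} {m : Pro x y} {n : Pro w z} {f : Arr x w} {g : Arr y z}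
    (a : Cell m n f g), eq_over (Cell m n) (ccomp (idC n) a) a;
  ccomp_idr : forall {x y w z} {m : Pro x y} {n : Pro w z} {f : Arr x w} {g : Arr y z}
    (a : Cell m n f g), eq_over (Cell m n) (ccomp a (idC m)) a;
  ccomp_assoc : forall {x y w z u v s t}
    {m : Pro x y} {n : Pro w z} {p : Pro u v} {q : Pro s t}
    {f : Arr x w} {g : Arr y z} {h : Arr w u} {k : Arr z v} {i : Arr u s} {j : Arr v t}
    (c : Cell p q i j) (b : Cell n p h k) (a : Cell m n f g),
    eq_over (Cell m q) (ccomp c (ccomp b a)) (ccomp (ccomp c b) a);

  idP : forall x, Pro x x;
  idPC : forall {x y} (f : Arr x y), Cell (idP x) (idP y) f f;
  idPC_id : forall x, idPC (idA x) = idC (idP x);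
  idPC_comp : forall {x y z} (g : Arr y z) (f : Arr x y),
    idPC (comp g f) = ccomp (idPC g) (idPC f);

  odot : forall {x y z}, Pro x y -> Pro y z -> Pro x z;
  codot : forall {x y z x' y' z'} {m : Pro x y} {n : Pro y z} {m' : Pro x' y'} {n' : Pro y' z'}
    {f : Arr x x'} {g : Arr y y'} {h : Arr z z'},
    Cell m m' f g -> Cell n n' g h -> Cell (odot m n) (odot m' n') f h;
  codot_id : forall {x y z} (m : Pro x y) (n : Pro y z),
    codot (idC m) (idC n) = idC (odot m n);
  codot_comp : forall {x y z x' y' z' x'' y'' z''}
    {m : Pro x y} {n : Pro y z} {m' : Pro x' y'} {n' : Pro y' z'}
    {m'' : Pro x'' y''} {n'' : Pro y'' z''}
    {f : Arr x x'} {g : Arr y y'} {h : Arr z z'}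
    {f' : Arr x' x''} {g' : Arr y' y''} {h' : Arr z' z''}
    (a' : Cell m' m'' f' g') (a : Cell m m' f g)
    (b' : Cell n' n'' g' h') (b : Cell n n' g h),
    codot (ccomp a' a) (ccomp b' b) = ccomp (codot a' b') (codot a b);

  assoc : forall {x y z t} (m : Pro x y) (n : Pro y z) (p : Pro z t),
    Cell (odot (odot m n) p) (odot m (odot n p)) (idA x) (idA t);
  assoc_inv : forall {x y z t} (m : Pro x y) (n : Pro y z) (p : Pro z t),
    Cell (odot m (odot n p)) (odot (odot m n) p) (idA x) (idA t);
  assocK : forall {x y z t} (m : Pro x y) (n : Pro y z) (p : Pro z t),
    eq_over (Cell _ _) (ccomp (assoc_inv m n p) (assoc m n p)) (idC _);
  assoc_invK : forall {x y z t} (m : Pro x y) (n : Pro y z) (p : Pro z t),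
    eq_over (Cell _ _) (ccomp (assoc m n p) (assoc_inv m n p)) (idC _);
  assoc_nat : forall {x y z t x' y' z' t'}
    {m : Pro x y} {n : Pro y z} {p : Pro z t} {m' : Pro x' y'} {n' : Pro y' z'} {p' : Pro z' t'}
    {f : Arr x x'} {g : Arr y y'} {h : Arr z z'} {k : Arr t t'}
    (a : Cell m m' f g) (b : Cell n n' g h) (c : Cell p p' h k),
    eq_over (Cell _ _) (ccomp (assoc m' n' p') (codot (codot a b) c))
                       (ccomp (codot a (codot b c)) (assoc m n p));

  lunit : forall {x y} (m : Pro x y), Cell (odot (idP x) m) m (idA x) (idA y);
  lunit_inv : forall {x y} (m : Pro x y), Cell m (odot (idP x) m) (idA x) (idA y);
  lunitK : forall {x y} (m : Pro x y),
    eq_over (Cell _ _) (ccomp (lunit_inv m) (lunit m)) (idC _);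
  lunit_invK : forall {x y} (m : Pro x y),
    eq_over (Cell _ _) (ccomp (lunit m) (lunit_inv m)) (idC _);
  lunit_nat : forall {x y w z} {m : Pro x y} {n : Pro w z} {f : Arr x w} {g : Arr y z}
    (a : Cell m n f g),
    eq_over (Cell _ _) (ccomp (lunit n) (codot (idPC f) a)) (ccomp a (lunit m));

  runit : forall {x y} (m : Pro x y), Cell (odot m (idP y)) m (idA x) (idA y);
  runit_inv : forall {x y} (m : Pro x y), Cell m (odot m (idP y)) (idA x) (idA y);
  runitK : forall {x y} (m : Pro x y),
    eq_over (Cell _ _) (ccomp (runit_inv m) (runit m)) (idC _);
  runit_invK : forall {x y} (m : Pro x y),
    eq_over (Cell _ _) (ccomp (runit m) (runit_inv m)) (idC _);
  runit_nat : forall {x y w z} {m : Pro x y} {n : Pro w z} {f : Arr x w} {g : Arr y z}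
    (a : Cell m n f g),
    eq_over (Cell _ _) (ccomp (runit n) (codot a (idPC g))) (ccomp a (runit m));

  pentagon : forall {x y z t s} (m : Pro x y) (n : Pro y z) (p : Pro z t) (q : Pro t s),
    eq_over (Cell _ _)
      (ccomp (assoc m n (odot p q)) (assoc (odot m n) p q))
      (ccomp (codot (idC m) (assoc n p q))
             (ccomp (assoc m (odot n p) q) (codot (assoc m n p) (idC q))));
  triangle : forall {x y z} (m : Pro x y) (n : Pro y z),
    eq_over (Cell _ _)
      (ccomp (codot (idC m) (lunit n)) (assoc m (idP y) n))
      (codot (runit m) (idC n))
}.

Arguments Arr {d} _ _.
Arguments Pro {d} _ _.
Arguments idA {d} _.
Arguments idP {d} _.

Declare Scope dbl_scope.
Open Scope dbl_scope.
Notation "g ∘ f" := (comp g f) (at level 40, left associativity) : dbl_scope.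
Notation "b ∙ a" := (ccomp b a) (at level 40, left associativity) : dbl_scope.
Notation "m ⊙ n" := (odot m n) (at level 38, left associativity) : dbl_scope.
Notation "a ⊛ b" := (codot a b) (at level 38, left associativity) : dbl_scope.
Notation "a ≡ b" := (eq_over (Cell _ _) a b) (at level 70, no associativity) : dbl_scope.

Definition is_restriction_cell {D : DoubleCategory} {x y w z : Ob D}
    {p : Pro x y} {n : Pro w z} {f : Arr x w} {g : Arr y z} (res : Cell p n f g) : Prop :=
  forall (u v : Ob D) (m : Pro u v) (h : Arr u x) (k : Arr v y)
    (c : Cell m n (f ∘ h) (g ∘ k)),
  exists! a : Cell m p h k, res ∙ a = c.

Record Restriction {D : DoubleCategory} {x y w z : Ob D}
    (n : Pro w z) (f : Arr x w) (g : Arr y z) := {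
  res_pro : Pro x y;
  res_cell : Cell res_pro n f g;
  res_cell_spec : is_restriction_cell res_cell
}.

Inductive ceq {D : DoubleCategory} {x y w z : Ob D} {m : Pro x y} {n : Pro w z}
    {f : Arr x w} {g : Arr y z} (a : Cell m n f g) :
  forall {x' y' w' z' : Ob D} {m' : Pro x' y'} {n' : Pro w' z'}
    {f' : Arr x' w'} {g' : Arr y' z'}, Cell m' n' f' g' -> Prop :=
| ceq_refl : ceq a a.

Section CellEquality.
Context {D : DoubleCategory}.

Lemma ceq_sym {x y w z : Ob D} {m : Pro x y} {n : Pro w z} {f : Arr x w} {g : Arr y z}
    {a : Cell m n f g} {x' y' w' z' : Ob D} {m' : Pro x' y'} {n' : Pro w' z'}
    {f' : Arr x' w'} {g' : Arr y' z'} {b : Cell m' n' f' g'} :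
  ceq a b -> ceq b a.
Proof. intros []; apply ceq_refl. Qed.

Lemma ceq_trans {x y w z : Ob D} {m : Pro x y} {n : Pro w z} {f : Arr x w} {g : Arr y z}
    {a : Cell m n f g} {x' y' w' z' : Ob D} {m' : Pro x' y'} {n' : Pro w' z'}
    {f' : Arr x' w'} {g' : Arr y' z'} {b : Cell m' n' f' g'}
    {x'' y'' w'' z'' : Ob D} {m'' : Pro x'' y''} {n'' : Pro w'' z''}
    {f'' : Arr x'' w''} {g'' : Arr y'' z''} {c : Cell m'' n'' f'' g''} :
  ceq a b -> ceq b c -> ceq a c.
Proof. intros H1 H2; destruct H2; exact H1. Qed.

Lemma ceq_eq {x y w z : Ob D} {m : Pro x y} {n : Pro w z} {f : Arr x w} {g : Arr y z}
    {a b : Cell m n f g} : ceq a b -> a = b.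
Proof. intros H; dependent destruction H; reflexivity. Qed.

Lemma eq_ceq {x y w z : Ob D} {m : Pro x y} {n : Pro w z} {f : Arr x w} {g : Arr y z}
    {a b : Cell m n f g} : a = b -> ceq a b.
Proof. intros []; apply ceq_refl. Qed.

Lemma ceq_over {x y w z : Ob D} {m : Pro x y} {n : Pro w z}
    {f f' : Arr x w} {g g' : Arr y z} {a : Cell m n f g} {b : Cell m n f' g'} :
  ceq a b -> a ≡ b.
Proof. intros H; dependent destruction H; apply eq_over_refl. Qed.

Lemma over_ceq {x y w z : Ob D} {m : Pro x y} {n : Pro w z}
    {f f' : Arr x w} {g g' : Arr y z} {a : Cell m n f g} {b : Cell m n f' g'} :
  a ≡ b -> ceq a b.
Proof. intros []; apply ceq_refl. Qed.

Lemma ceq_comp {x y w z u v : Ob D} {m : Pro x y} {n : Pro w z} {p : Pro u v}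
    {f : Arr x w} {g : Arr y z} {h : Arr w u} {k : Arr z v}
    {b : Cell n p h k} {a : Cell m n f g}
    {x' y' w' z' u' v' : Ob D} {m' : Pro x' y'} {n' : Pro w' z'} {p' : Pro u' v'}
    {f' : Arr x' w'} {g' : Arr y' z'} {h' : Arr w' u'} {k' : Arr z' v'}
    {b' : Cell n' p' h' k'} {a' : Cell m' n' f' g'} :
  ceq b b' -> ceq a a' -> ceq (b ∙ a) (b' ∙ a').
Proof.
  intros Hb Ha; revert b' Hb; destruct Ha; intros b' Hb.
  dependent destruction Hb; apply ceq_refl.
Qed.

Lemma ceq_odot {x y z x' y' z' : Ob D}
    {m : Pro x y} {n : Pro y z} {m' : Pro x' y'} {n' : Pro y' z'}
    {f : Arr x x'} {g : Arr y y'} {h : Arr z z'}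
    {a : Cell m m' f g} {b : Cell n n' g h}
    {x1 y1 z1 x1' y1' z1' : Ob D}
    {m1 : Pro x1 y1} {n1 : Pro y1 z1} {m1' : Pro x1' y1'} {n1' : Pro y1' z1'}
    {f1 : Arr x1 x1'} {g1 : Arr y1 y1'} {h1 : Arr z1 z1'}
    {a1 : Cell m1 m1' f1 g1} {b1 : Cell n1 n1' g1 h1} :
  ceq a a1 -> ceq b b1 -> ceq (a ⊛ b) (a1 ⊛ b1).
Proof.
  intros Ha Hb; revert b1 Hb; destruct Ha; intros b1 Hb.
  dependent destruction Hb; apply ceq_refl.
Qed.

Definition cast_src {x y w z : Ob D} {m m' : Pro x y} {n : Pro w z}
    {f : Arr x w} {g : Arr y z} (e : m = m') (a : Cell m n f g) : Cell m' n f g :=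
  match e in _ = m0 return Cell m0 n f g with eq_refl => a end.

Definition cast_sides {x y w z : Ob D} {m : Pro x y} {n : Pro w z}
    {f f' : Arr x w} {g g' : Arr y z} (ef : f = f') (eg : g = g') (a : Cell m n f g) :
    Cell m n f' g' :=
  match ef in _ = f0, eg in _ = g0 return Cell m n f0 g0 with
  | eq_refl, eq_refl => a
  end.

Lemma cast_src_ceq {x y w z : Ob D} {m m' : Pro x y} {n : Pro w z}
    {f : Arr x w} {g : Arr y z} (e : m = m') (a : Cell m n f g) : ceq (cast_src e a) a.
Proof. destruct e; apply ceq_refl. Qed.

Lemma cast_sides_ceq {x y w z : Ob D} {m : Pro x y} {n : Pro w z}
    {f f' : Arr x w} {g g' : Arr y z} (ef : f = f') (eg : g = g') (a : Cell m n f g) :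
  ceq (cast_sides ef eg a) a.
Proof. destruct ef, eg; apply ceq_refl. Qed.

End CellEquality.

Local Tactic Notation "cstep" uconstr(H) := eapply ceq_trans; [refine H; try reflexivity|].

Record LaxFunctor (C D : DoubleCategory) := {
  lf_ob :> Ob C -> Ob D;
  lf_arr : forall {x y}, Arr x y -> Arr (lf_ob x) (lf_ob y);
  lf_arr_id : forall x, lf_arr (idA x) = idA (lf_ob x);
  lf_arr_comp : forall {x y z} (g : Arr y z) (f : Arr x y),
    lf_arr (g ∘ f) = lf_arr g ∘ lf_arr f;
  lf_pro : forall {x y}, Pro x y -> Pro (lf_ob x) (lf_ob y);
  lf_cell : forall {x y w z} {m : Pro x y} {n : Pro w z} {f : Arr x w} {g : Arr y z},
    Cell m n f g -> Cell (lf_pro m) (lf_pro n) (lf_arr f) (lf_arr g);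
  lf_cell_id : forall {x y} (m : Pro x y), lf_cell (idC m) ≡ idC (lf_pro m);
  lf_cell_comp : forall {x y w z u v} {m : Pro x y} {n : Pro w z} {p : Pro u v}
    {f : Arr x w} {g : Arr y z} {h : Arr w u} {k : Arr z v}
    (b : Cell n p h k) (a : Cell m n f g),
    lf_cell (b ∙ a) ≡ lf_cell b ∙ lf_cell a;
  lf_mu : forall {x y z} (m : Pro x y) (n : Pro y z),
    Cell (lf_pro m ⊙ lf_pro n) (lf_pro (m ⊙ n)) (idA (lf_ob x)) (idA (lf_ob z));
  lf_eta : forall x, Cell (idP (lf_ob x)) (lf_pro (idP x)) (idA (lf_ob x)) (idA (lf_ob x));
  lf_mu_nat : forall {x y z x' y' z'}
    {m : Pro x y} {n : Pro y z} {m' : Pro x' y'} {n' : Pro y' z'}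
    {f : Arr x x'} {g : Arr y y'} {h : Arr z z'} (a : Cell m m' f g) (b : Cell n n' g h),
    lf_cell (a ⊛ b) ∙ lf_mu m n ≡ lf_mu m' n' ∙ (lf_cell a ⊛ lf_cell b);
  lf_eta_nat : forall {x y} (f : Arr x y),
    lf_cell (idPC f) ∙ lf_eta x ≡ lf_eta y ∙ idPC (lf_arr f);
  lf_mu_assoc : forall {x y z t} (m : Pro x y) (n : Pro y z) (p : Pro z t),
    lf_cell (assoc m n p) ∙ (lf_mu (m ⊙ n) p ∙ (lf_mu m n ⊛ idC (lf_pro p)))
    ≡ lf_mu m (n ⊙ p) ∙ ((idC (lf_pro m) ⊛ lf_mu n p) ∙ assoc (lf_pro m) (lf_pro n) (lf_pro p));
  lf_lunit : forall {x y} (m : Pro x y),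
    lf_cell (lunit m) ∙ (lf_mu (idP x) m ∙ (lf_eta x ⊛ idC (lf_pro m))) ≡ lunit (lf_pro m);
  lf_runit : forall {x y} (m : Pro x y),
    lf_cell (runit m) ∙ (lf_mu m (idP y) ∙ (idC (lf_pro m) ⊛ lf_eta y)) ≡ runit (lf_pro m)
}.

Arguments lf_eta {C D} _ _.

Record NatTrans {C D : DoubleCategory} (F G : LaxFunctor C D) := {
  nt_arr : forall x, Arr (F x) (G x);
  nt_arr_nat : forall {x y} (f : Arr x y),
    lf_arr G f ∘ nt_arr x = nt_arr y ∘ lf_arr F f;
  nt_cell : forall {x y} (m : Pro x y), Cell (lf_pro F m) (lf_pro G m) (nt_arr x) (nt_arr y);
  nt_cell_nat : forall {x y w z} {m : Pro x y} {n : Pro w z} {f : Arr x w} {g : Arr y z}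
    (a : Cell m n f g),
    lf_cell G a ∙ nt_cell m ≡ nt_cell n ∙ lf_cell F a;
  nt_mu : forall {x y z} (m : Pro x y) (n : Pro y z),
    nt_cell (m ⊙ n) ∙ lf_mu F m n ≡ lf_mu G m n ∙ (nt_cell m ⊛ nt_cell n);
  nt_eta : forall x, nt_cell (idP x) ∙ lf_eta F x ≡ lf_eta G x ∙ idPC (nt_arr x)
}.

Section Functors.

Lemma lf_ceq {C D : DoubleCategory} (F : LaxFunctor C D)
    {x y w z : Ob C} {m : Pro x y} {n : Pro w z} {f : Arr x w} {g : Arr y z}
    {a : Cell m n f g} {x' y' w' z' : Ob C} {m' : Pro x' y'} {n' : Pro w' z'}
    {f' : Arr x' w'} {g' : Arr y' z'} {b : Cell m' n' f' g'} :
  ceq a b -> ceq (lf_cell F a) (lf_cell F b).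
Proof. intros []; apply ceq_refl. Qed.

Lemma lf_slide {C D : DoubleCategory} (F : LaxFunctor C D)
    {x y w z u v : Ob C} {m : Pro x y} {n : Pro w z} {p : Pro u v}
    {f : Arr x w} {g : Arr y z} {h : Arr w u} {k : Arr z v}
    {b : Cell n p h k} {a : Cell m n f g}
    {w' z' : Ob C} {n' : Pro w' z'} {f' : Arr x w'} {g' : Arr y z'}
    {h' : Arr w' u} {k' : Arr z' v} {b' : Cell n' p h' k'} {a' : Cell m n' f' g'} :
  b ∙ a ≡ b' ∙ a' -> ceq (lf_cell F b ∙ lf_cell F a) (lf_cell F b' ∙ lf_cell F a').
Proof.
  intros H.
  cstep (ceq_sym (over_ceq (lf_cell_comp F b a))).
  cstep (lf_ceq F (over_ceq H)).
  apply over_ceq, lf_cell_comp.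
Qed.

Program Definition id_lax (C : DoubleCategory) : LaxFunctor C C := {|
  lf_ob := fun x => x;
  lf_arr := fun _ _ f => f;
  lf_pro := fun _ _ m => m;
  lf_cell := fun _ _ _ _ _ _ _ _ a => a;
  lf_mu := fun _ _ _ m n => idC (m ⊙ n);
  lf_eta := fun x => idC (idP x)
|}.
Next Obligation. apply eq_over_refl. Qed.
Next Obligation. apply eq_over_refl. Qed.
Next Obligation.
  apply ceq_over, (ceq_trans (over_ceq (ccomp_idr _))), ceq_sym, over_ceq, ccomp_idl.
Qed.
Next Obligation.
  apply ceq_over, (ceq_trans (over_ceq (ccomp_idr _))), ceq_sym, over_ceq, ccomp_idl.
Qed.
Next Obligation.
  rewrite !codot_id.
  apply ceq_over.
  eapply ceq_trans;
    [ eapply ceq_comp; [apply ceq_refl | apply over_ceq, ccomp_idl] |].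
  eapply ceq_trans; [apply over_ceq, ccomp_idr|].
  apply ceq_sym.
  eapply ceq_trans; [apply over_ceq, ccomp_idl|].
  apply over_ceq, ccomp_idl.
Qed.
Next Obligation.
  rewrite !codot_id.
  apply ceq_over.
  eapply ceq_trans;
    [ eapply ceq_comp; [apply ceq_refl | apply over_ceq, ccomp_idl] |].
  apply over_ceq, ccomp_idr.
Qed.
Next Obligation.
  rewrite !codot_id.
  apply ceq_over.
  eapply ceq_trans;
    [ eapply ceq_comp; [apply ceq_refl | apply over_ceq, ccomp_idl] |].
  apply over_ceq, ccomp_idr.
Qed.

Section Composite.
Context {B C D : DoubleCategory} (G : LaxFunctor C D) (F : LaxFunctor B C).

Lemma comp_lax_side x : lf_arr G (idA (F x)) ∘ idA (G (F x)) = idA (G (F x)).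
Proof. now rewrite comp_idr, lf_arr_id. Qed.

Definition comp_mu {x y z : Ob B} (m : Pro x y) (n : Pro y z) :
    Cell (lf_pro G (lf_pro F m) ⊙ lf_pro G (lf_pro F n)) (lf_pro G (lf_pro F (m ⊙ n)))
      (idA (G (F x))) (idA (G (F z))) :=
  cast_sides (comp_lax_side x) (comp_lax_side z)
    (lf_cell G (lf_mu F m n) ∙ lf_mu G (lf_pro F m) (lf_pro F n)).

Definition comp_eta (x : Ob B) :
    Cell (idP (G (F x))) (lf_pro G (lf_pro F (idP x))) (idA (G (F x))) (idA (G (F x))) :=
  cast_sides (comp_lax_side x) (comp_lax_side x) (lf_cell G (lf_eta F x) ∙ lf_eta G (F x)).

Lemma comp_mu_ceq {x y z : Ob B} (m : Pro x y) (n : Pro y z) :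
  ceq (comp_mu m n) (lf_cell G (lf_mu F m n) ∙ lf_mu G (lf_pro F m) (lf_pro F n)).
Proof. apply cast_sides_ceq. Qed.

Lemma comp_eta_ceq (x : Ob B) :
  ceq (comp_eta x) (lf_cell G (lf_eta F x) ∙ lf_eta G (F x)).
Proof. apply cast_sides_ceq. Qed.

Lemma comp_mu_whisker_r {x y z : Ob B} {l : Pro x y} {l0 : Pro (G (F x)) (G (F y))}
    {l1 : Pro (F x) (F y)}
    {c : Cell l0 (lf_pro G (lf_pro F l)) (idA _) (idA _)}
    {b : Cell l1 (lf_pro F l) (idA _) (idA _)}
    {a : Cell l0 (lf_pro G l1) (idA _) (idA _)}
    (H : ceq c (lf_cell G b ∙ a)) (p : Pro y z) :
  ceq (comp_mu l p ∙ (c ⊛ idC (lf_pro G (lf_pro F p))))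
      (lf_cell G (lf_mu F l p ∙ (b ⊛ idC (lf_pro F p)))
       ∙ (lf_mu G l1 (lf_pro F p) ∙ (a ⊛ idC (lf_pro G (lf_pro F p))))).
Proof.
  assert (Hid : ceq (idC (lf_pro G (lf_pro F p)))
                    (lf_cell G (idC (lf_pro F p)) ∙ idC (lf_pro G (lf_pro F p)))).
  { apply ceq_sym; cstep (over_ceq (ccomp_idr (lf_cell G (idC (lf_pro F p))))).
    apply over_ceq, lf_cell_id. }
  cstep (ceq_comp (comp_mu_ceq l p) (ceq_odot H Hid)).
  rewrite codot_comp.
  cstep (ceq_sym (over_ceq (ccomp_assoc (lf_cell G (lf_mu F l p)) (lf_mu G _ _)
     ((lf_cell G b ⊛ lf_cell G (idC (lf_pro F p))) ∙ (a ⊛ idC _))))).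
  cstep (ceq_comp (ceq_refl (lf_cell G (lf_mu F l p)))
     (over_ceq (ccomp_assoc (lf_mu G (lf_pro F l) (lf_pro F p))
         (lf_cell G b ⊛ lf_cell G (idC (lf_pro F p))) (a ⊛ idC _)))).
  cstep (ceq_comp (ceq_refl (lf_cell G (lf_mu F l p)))
     (ceq_comp (ceq_sym (over_ceq (lf_mu_nat G b (idC (lf_pro F p))))) (ceq_refl (a ⊛ idC _)))).
  cstep (ceq_comp (ceq_refl (lf_cell G (lf_mu F l p)))
     (ceq_sym (over_ceq (ccomp_assoc (lf_cell G (b ⊛ idC (lf_pro F p)))
         (lf_mu G l1 (lf_pro F p)) (a ⊛ idC _))))).
  cstep (over_ceq (ccomp_assoc (lf_cell G (lf_mu F l p)) (lf_cell G (b ⊛ idC (lf_pro F p)))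
         (lf_mu G l1 (lf_pro F p) ∙ (a ⊛ idC _)))).
  apply ceq_comp; [|apply ceq_refl].
  apply ceq_sym, over_ceq, lf_cell_comp.
Qed.

Lemma comp_mu_whisker_l {x y z : Ob B} (p : Pro x y) {l : Pro y z}
    {l0 : Pro (G (F y)) (G (F z))} {l1 : Pro (F y) (F z)}
    {c : Cell l0 (lf_pro G (lf_pro F l)) (idA _) (idA _)}
    {b : Cell l1 (lf_pro F l) (idA _) (idA _)}
    {a : Cell l0 (lf_pro G l1) (idA _) (idA _)}
    (H : ceq c (lf_cell G b ∙ a)) :
  ceq (comp_mu p l ∙ (idC (lf_pro G (lf_pro F p)) ⊛ c))
      (lf_cell G (lf_mu F p l ∙ (idC (lf_pro F p) ⊛ b))
       ∙ (lf_mu G (lf_pro F p) l1 ∙ (idC (lf_pro G (lf_pro F p)) ⊛ a))).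
Proof.
  assert (Hid : ceq (idC (lf_pro G (lf_pro F p)))
                    (lf_cell G (idC (lf_pro F p)) ∙ idC (lf_pro G (lf_pro F p)))).
  { apply ceq_sym; cstep (over_ceq (ccomp_idr (lf_cell G (idC (lf_pro F p))))).
    apply over_ceq, lf_cell_id. }
  cstep (ceq_comp (comp_mu_ceq p l) (ceq_odot Hid H)).
  rewrite codot_comp.
  cstep (ceq_sym (over_ceq (ccomp_assoc (lf_cell G (lf_mu F p l)) (lf_mu G _ _)
     ((lf_cell G (idC (lf_pro F p)) ⊛ lf_cell G b) ∙ (idC _ ⊛ a))))).
  cstep (ceq_comp (ceq_refl (lf_cell G (lf_mu F p l)))
     (over_ceq (ccomp_assoc (lf_mu G (lf_pro F p) (lf_pro F l))
         (lf_cell G (idC (lf_pro F p)) ⊛ lf_cell G b) (idC _ ⊛ a)))).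
  cstep (ceq_comp (ceq_refl (lf_cell G (lf_mu F p l)))
     (ceq_comp (ceq_sym (over_ceq (lf_mu_nat G (idC (lf_pro F p)) b))) (ceq_refl (idC _ ⊛ a)))).
  cstep (ceq_comp (ceq_refl (lf_cell G (lf_mu F p l)))
     (ceq_sym (over_ceq (ccomp_assoc (lf_cell G (idC (lf_pro F p) ⊛ b))
         (lf_mu G (lf_pro F p) l1) (idC _ ⊛ a))))).
  cstep (over_ceq (ccomp_assoc (lf_cell G (lf_mu F p l)) (lf_cell G (idC (lf_pro F p) ⊛ b))
         (lf_mu G (lf_pro F p) l1 ∙ (idC _ ⊛ a)))).
  apply ceq_comp; [|apply ceq_refl].
  apply ceq_sym, over_ceq, lf_cell_comp.
Qed.

Program Definition comp_lax : LaxFunctor B D := {|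
  lf_ob := fun x => G (F x);
  lf_arr := fun _ _ f => lf_arr G (lf_arr F f);
  lf_pro := fun _ _ m => lf_pro G (lf_pro F m);
  lf_cell := fun _ _ _ _ _ _ _ _ a => lf_cell G (lf_cell F a);
  lf_mu := fun _ _ _ m n => comp_mu m n;
  lf_eta := comp_eta
|}.
Next Obligation. now rewrite !lf_arr_id. Qed.
Next Obligation. now rewrite !lf_arr_comp. Qed.
Next Obligation.
  apply ceq_over; cstep (lf_ceq G (over_ceq (lf_cell_id F m))).
  apply over_ceq, lf_cell_id.
Qed.
Next Obligation.
  apply ceq_over; cstep (lf_ceq G (over_ceq (lf_cell_comp F b a))).
  apply over_ceq, lf_cell_comp.
Qed.
Next Obligation.
  apply ceq_over.
  cstep (ceq_comp (ceq_refl _) (comp_mu_ceq m n)).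
  cstep (over_ceq (ccomp_assoc _ _ _)).
  cstep (ceq_comp (lf_slide G (lf_mu_nat F a b)) (ceq_refl _)).
  cstep (ceq_sym (over_ceq (ccomp_assoc _ _ _))).
  cstep (ceq_comp (ceq_refl (lf_cell G (lf_mu F m' n')))
    (over_ceq (lf_mu_nat G (lf_cell F a) (lf_cell F b)))).
  cstep (over_ceq (ccomp_assoc _ _ _)).
  exact (ceq_comp (ceq_sym (comp_mu_ceq m' n')) (ceq_refl _)).
Qed.
Next Obligation.
  apply ceq_over.
  cstep (ceq_comp (ceq_refl _) (comp_eta_ceq x)).
  cstep (over_ceq (ccomp_assoc _ _ _)).
  cstep (ceq_comp (lf_slide G (lf_eta_nat F f)) (ceq_refl _)).
  cstep (ceq_sym (over_ceq (ccomp_assoc _ _ _))).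
  cstep (ceq_comp (ceq_refl (lf_cell G (lf_eta F y)))
    (over_ceq (lf_eta_nat G (lf_arr F f)))).
  cstep (over_ceq (ccomp_assoc _ _ _)).
  exact (ceq_comp (ceq_sym (comp_eta_ceq y)) (ceq_refl _)).
Qed.
Next Obligation.
  apply ceq_over.
  cstep (ceq_comp (ceq_refl (lf_cell G (lf_cell F (assoc m n p))))
    (comp_mu_whisker_r (comp_mu_ceq m n) p)).
  cstep (over_ceq (ccomp_assoc _ _ _)).
  cstep (ceq_comp (lf_slide G (lf_mu_assoc F m n p)) (ceq_refl _)).
  cstep (ceq_sym (over_ceq (ccomp_assoc _ _ _))).
  cstep (ceq_comp (ceq_refl (lf_cell G (lf_mu F m (n ⊙ p))))
           (ceq_comp (over_ceq (lf_cell_comp G _ _)) (ceq_refl _))).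
  cstep (ceq_comp (ceq_refl (lf_cell G (lf_mu F m (n ⊙ p))))
           (ceq_sym (over_ceq (ccomp_assoc _ _ _)))).
  cstep (ceq_comp (ceq_refl (lf_cell G (lf_mu F m (n ⊙ p))))
           (ceq_comp (ceq_refl (lf_cell G (idC (lf_pro F m) ⊛ lf_mu F n p)))
              (over_ceq (lf_mu_assoc G (lf_pro F m) (lf_pro F n) (lf_pro F p))))).
  apply ceq_sym.
  cstep (over_ceq (ccomp_assoc (comp_mu m (n ⊙ p))
    (idC (lf_pro G (lf_pro F m)) ⊛ comp_mu n p)
    (assoc (lf_pro G (lf_pro F m)) (lf_pro G (lf_pro F n)) (lf_pro G (lf_pro F p))))).
  cstep (ceq_comp (comp_mu_whisker_l m (comp_mu_ceq n p)) (ceq_refl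
    (assoc (lf_pro G (lf_pro F m)) (lf_pro G (lf_pro F n)) (lf_pro G (lf_pro F p))))).
  cstep (ceq_sym (over_ceq (ccomp_assoc _ _ _))).
  cstep (ceq_comp (over_ceq (lf_cell_comp G (lf_mu F m (n ⊙ p)) (idC (lf_pro F m) ⊛ lf_mu F n p)))
   (ceq_refl
     (lf_mu G (lf_pro F m) (lf_pro F n ⊙ lf_pro F p)
      ∙ (idC (lf_pro G (lf_pro F m)) ⊛ lf_mu G (lf_pro F n) (lf_pro F p))
      ∙ assoc (lf_pro G (lf_pro F m)) (lf_pro G (lf_pro F n)) (lf_pro G (lf_pro F p))))).
  cstep (ceq_sym (over_ceq (ccomp_assoc _ _ _))).
  apply ceq_comp; [apply ceq_refl|].
  apply ceq_comp; [apply ceq_refl|].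
  apply ceq_sym, over_ceq, ccomp_assoc.
Qed.
Next Obligation.
  apply ceq_over.
  cstep (ceq_comp (ceq_refl (lf_cell G (lf_cell F (lunit m))))
    (comp_mu_whisker_r (comp_eta_ceq x) m)).
  cstep (over_ceq (ccomp_assoc _ _ _)).
  cstep (ceq_comp (ceq_trans (ceq_sym (over_ceq (lf_cell_comp G _ _)))
                     (lf_ceq G (over_ceq (lf_lunit F m)))) (ceq_refl _)).
  apply over_ceq, lf_lunit.
Qed.
Next Obligation.
  apply ceq_over.
  cstep (ceq_comp (ceq_refl (lf_cell G (lf_cell F (runit m))))
    (comp_mu_whisker_l m (comp_eta_ceq y))).
  cstep (over_ceq (ccomp_assoc _ _ _)).
  cstep (ceq_comp (ceq_trans (ceq_sym (over_ceq (lf_cell_comp G _ _)))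
                     (lf_ceq G (over_ceq (lf_runit F m)))) (ceq_refl _)).
  apply over_ceq, lf_runit.
Qed.

End Composite.
End Functors.

Record Adjunction {C D : DoubleCategory} (F : LaxFunctor C D) (G : LaxFunctor D C) := {
  adj_unit : NatTrans (id_lax C) (comp_lax G F);
  adj_counit : NatTrans (comp_lax F G) (id_lax D);
  adj_left_arr : forall x : Ob C,
    nt_arr adj_counit (F x) ∘ lf_arr F (nt_arr adj_unit x) = idA (F x);
  adj_left_cell : forall (x y : Ob C) (m : Pro x y),
    nt_cell adj_counit (lf_pro F m) ∙ lf_cell F (nt_cell adj_unit m) ≡ idC (lf_pro F m);
  adj_right_arr : forall x : Ob D,
    lf_arr G (nt_arr adj_counit x) ∘ nt_arr adj_unit (G x) = idA (G x);
  adj_right_cell : forall (x y : Ob D) (m : Pro x y),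
    lf_cell G (nt_cell adj_counit m) ∙ nt_cell adj_unit (lf_pro G m) ≡ idC (lf_pro G m)
}.

Record Span (I J : Type) := {
  apex :> Type;
  lleg : apex -> I;
  rleg : apex -> J
}.

(** [elt A i j] is the type of elements [a : i ⇸ j] of the span [A]. *)
Record elt {I J : Type} (A : Span I J) (i : I) (j : J) := Elt {
  elt_val :> A;
  elt_l : lleg elt_val = i;
  elt_r : rleg elt_val = j
}.
Arguments Elt {I J A i j} _ _ _.

Definition this {I J : Type} {A : Span I J} (a : A) : elt A (lleg a) (rleg a) :=
  Elt a eq_refl eq_refl.

(** To define something for all [a : i ⇸ j] it suffices to define it when [i] and
    [j] are the legs of [a]. *)
Definition elt_case {I J : Type} {A : Span I J} (P : forall i j, elt A i j -> Type)
    (u : forall a : A, P _ _ (this a)) {i : I} {j : J} (a : elt A i j) : P i j a :=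
  match a with
  | Elt v p q =>
      match p as p0 in _ = i0, q as q0 in _ = j0 return P i0 j0 (Elt v p0 q0) with
      | eq_refl, eq_refl => u v
      end
  end.

Record SpanMap {I J K L : Type} (B : Span K L) (A : Span I J) (f : K -> I) (g : L -> J) := {
  sm_fun :> B -> A;
  sm_l : forall b, lleg (sm_fun b) = f (lleg b);
  sm_r : forall b, rleg (sm_fun b) = g (rleg b)
}.

Definition sm_elt {I J K L : Type} {B : Span K L} {A : Span I J} {f : K -> I} {g : L -> J}
    (s : SpanMap B A f g) {k : K} {l : L} (b : elt B k l) : elt A (f k) (g l) :=
  Elt (s b) (eq_trans (sm_l s b) (f_equal f (elt_l b)))
            (eq_trans (sm_r s b) (f_equal g (elt_r b))).

Record pullback_apex {I J K : Type} (A : Span I J) (B : Span J K) := Pb {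
  pb_fst : A;
  pb_snd : B;
  pb_eq : rleg pb_fst = lleg pb_snd
}.
Arguments Pb {I J K A B} _ _ _.

Definition unit_span (I : Type) : Span I I :=
  {| apex := I; lleg := fun i => i; rleg := fun i => i |}.

Definition comp_span {I J K : Type} (A : Span I J) (B : Span J K) : Span I K := {|
  apex := pullback_apex A B;
  lleg := fun c => lleg (pb_fst c);
  rleg := fun c => rleg (pb_snd c)
|}.

(** The span [I <- K <- B -> L -> J]. *)
Definition extend_span {I J K L : Type} (f : K -> I) (B : Span K L) (g : L -> J) : Span I J := {|
  apex := B;
  lleg := fun b => f (lleg b);
  rleg := fun b => g (rleg b)
|}.

(** The components [a : i ⇸ j] and [b : j ⇸ k], where [j] is the common leg, of
    an element of a pullback. *)
Definition elt_fst {I J K : Type} {A : Span I J} {B : Span J K} {i k}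
    (c : elt (comp_span A B) i k) : elt A i (rleg (pb_fst (elt_val c))) :=
  Elt (pb_fst (elt_val c)) (elt_l c) eq_refl.

Definition elt_snd {I J K : Type} {A : Span I J} {B : Span J K} {i k}
    (c : elt (comp_span A B) i k) : elt B (rleg (pb_fst (elt_val c))) k :=
  Elt (pb_snd (elt_val c)) (eq_sym (pb_eq (elt_val c))) (elt_r c).

Lemma elt_eq {I J : Type} {A : Span I J} {i j} (a b : elt A i j) :
  elt_val a = elt_val b -> a = b.
Proof.
  destruct a as [a p q], b as [b p' q']; simpl; intros <-.
  now rewrite (proof_irrelevance _ p p'), (proof_irrelevance _ q q').
Qed.

Lemma pb_ext {I J K : Type} {A : Span I J} {B : Span J K} (c d : pullback_apex A B) :
  pb_fst c = pb_fst d -> pb_snd c = pb_snd d -> c = d.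
Proof.
  destruct c as [a b e], d as [a' b' e']; simpl; intros <- <-.
  now rewrite (proof_irrelevance _ e e').
Qed.

Lemma lunit_span_case {I J : Type} {A : Span I J} (P : pullback_apex (unit_span I) A -> Prop) :
  (forall a : A, P (Pb (A := unit_span I) (lleg a) a eq_refl)) -> forall c, P c.
Proof.
  intros H [i a e].
  replace (Pb i a e) with (Pb (A := unit_span I) (lleg a) a eq_refl); [apply H|].
  now apply pb_ext.
Qed.

Lemma sm_ext {I J K L : Type} {B : Span K L} {A : Span I J} {f : K -> I} {g : L -> J}
    (s t : SpanMap B A f g) : (forall b, s b = t b) -> s = t.
Proof.
  destruct s as [s p q], t as [t p' q']; simpl; intros H.
  apply functional_extensionality in H; subst t.
  now rewrite (proof_irrelevance _ p p'), (proof_irrelevance _ q q').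
Qed.

Definition sm_id {I J : Type} (A : Span I J) : SpanMap A A (fun i => i) (fun j => j) :=
  {| sm_fun := fun a => a; sm_l := fun a => eq_refl; sm_r := fun a => eq_refl |}.

Definition sm_comp {I J K L M N : Type} {C : Span M N} {B : Span K L} {A : Span I J}
    {f : K -> I} {g : L -> J} {h : M -> K} {k : N -> L}
    (s : SpanMap B A f g) (t : SpanMap C B h k) :
    SpanMap C A (fun m => f (h m)) (fun n => g (k n)) := {|
  sm_fun := fun c => s (t c);
  sm_l := fun c => eq_trans (sm_l s (t c)) (f_equal f (sm_l t c));
  sm_r := fun c => eq_trans (sm_r s (t c)) (f_equal g (sm_r t c))
|}.

Definition sm_unit {I K : Type} (f : K -> I) : SpanMap (unit_span K) (unit_span I) f f := {|
  sm_fun := (f : unit_span K -> unit_span I);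
  sm_l := fun _ => eq_refl;
  sm_r := fun _ => eq_refl
|}.

Definition sm_odot {I J H K L M : Type} {A : Span I J} {B : Span J H} {A' : Span K L}
    {B' : Span L M} {f : K -> I} {g : L -> J} {h : M -> H}
    (s : SpanMap A' A f g) (t : SpanMap B' B g h) :
    SpanMap (comp_span A' B') (comp_span A B) f h := {|
  sm_fun := fun c : comp_span A' B' =>
    (Pb (A := A) (B := B) (s (pb_fst c)) (t (pb_snd c))
       (eq_trans (sm_r s (pb_fst c))
          (eq_trans (f_equal g (pb_eq c)) (eq_sym (sm_l t (pb_snd c))))) : comp_span A B);
  sm_l := fun c => sm_l s (pb_fst c);
  sm_r := fun c => sm_r t (pb_snd c)
|}.

Definition sm_assoc {I J K L : Type} (A : Span I J) (B : Span J K) (C : Span K L) :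
    SpanMap (comp_span A (comp_span B C)) (comp_span (comp_span A B) C)
      (fun i => i) (fun l => l) := {|
  sm_fun := fun d : comp_span A (comp_span B C) =>
    (Pb (A := comp_span A B) (B := C)
       (Pb (pb_fst d) (pb_fst (pb_snd d)) (pb_eq d)) (pb_snd (pb_snd d)) (pb_eq (pb_snd d))
     : comp_span (comp_span A B) C);
  sm_l := fun _ => eq_refl;
  sm_r := fun _ => eq_refl
|}.

Definition sm_assoc_inv {I J K L : Type} (A : Span I J) (B : Span J K) (C : Span K L) :
    SpanMap (comp_span (comp_span A B) C) (comp_span A (comp_span B C))
      (fun i => i) (fun l => l) := {|
  sm_fun := fun d : comp_span (comp_span A B) C =>
    (Pb (A := A) (B := comp_span B C)
       (pb_fst (pb_fst d)) (Pb (pb_snd (pb_fst d)) (pb_snd d) (pb_eq d)) (pb_eq (pb_fst d))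
     : comp_span A (comp_span B C));
  sm_l := fun _ => eq_refl;
  sm_r := fun _ => eq_refl
|}.

Definition sm_lunit {I J : Type} (A : Span I J) :
    SpanMap A (comp_span (unit_span I) A) (fun i => i) (fun j => j) := {|
  sm_fun := fun a => (Pb (A := unit_span I) (lleg a) a eq_refl : comp_span (unit_span I) A);
  sm_l := fun _ => eq_refl;
  sm_r := fun _ => eq_refl
|}.

Definition sm_lunit_inv {I J : Type} (A : Span I J) :
    SpanMap (comp_span (unit_span I) A) A (fun i => i) (fun j => j) := {|
  sm_fun := fun c : comp_span (unit_span I) A => pb_snd c;
  sm_l := fun c => eq_sym (pb_eq c);
  sm_r := fun _ => eq_refl
|}.

Definition sm_runit {I J : Type} (A : Span I J) :
    SpanMap A (comp_span A (unit_span J)) (fun i => i) (fun j => j) := {|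
  sm_fun := fun a => (Pb (B := unit_span J) a (rleg a) eq_refl : comp_span A (unit_span J));
  sm_l := fun _ => eq_refl;
  sm_r := fun _ => eq_refl
|}.

Definition sm_runit_inv {I J : Type} (A : Span I J) :
    SpanMap (comp_span A (unit_span J)) A (fun i => i) (fun j => j) := {|
  sm_fun := fun c : comp_span A (unit_span J) => pb_fst c;
  sm_l := fun _ => eq_refl;
  sm_r := fun c => pb_eq c
|}.

Section Families.
Context (D : DoubleCategory).

Record FamOb := {
  fo_idx : Type;
  fo_ob :> fo_idx -> Ob D
}.

Record FamArr (X Y : FamOb) := {
  fa_idx : fo_idx Y -> fo_idx X;
  fa_arr :> forall j, Arr (X (fa_idx j)) (Y j)
}.

(** The member [m_a : x_i ⇸ y_j] is given for each [a : i ⇸ j], that is for all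
    [i] and [j] provably equal to the legs of [a], so that members can be
    composed along the pullback of two spans without transport. *)
Record FamPro (X Y : FamOb) := {
  fp_span : Span (fo_idx X) (fo_idx Y);
  fp_pro :> forall i j, elt fp_span i j -> Pro (X i) (Y j)
}.
Arguments fp_span {X Y} _.
Arguments fp_pro {X Y} _ {i j} _.

Record FamCell {X Y W Z : FamOb} (m : FamPro X Y) (n : FamPro W Z)
    (f : FamArr X W) (g : FamArr Y Z) := {
  fc_map : SpanMap (fp_span n) (fp_span m) (fa_idx f) (fa_idx g);
  fc_cell :> forall k l (b : elt (fp_span n) k l), Cell (m _ _ (sm_elt fc_map b)) (n _ _ b) (f k) (g l)
}.
Arguments fc_map {X Y W Z m n f g} _.
Arguments fc_cell {X Y W Z m n f g} _ {k l} _.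

Definition fam_idA (X : FamOb) : FamArr X X :=
  {| fa_idx := fun i => i; fa_arr := fun i => idA (X i) |}.

Definition fam_comp {X Y Z : FamOb} (g : FamArr Y Z) (f : FamArr X Y) : FamArr X Z :=
  {| fa_idx := fun k => fa_idx f (fa_idx g k); fa_arr := fun k => g k ∘ f (fa_idx g k) |}.

Lemma fam_arr_ext {X Y : FamOb} (u : fo_idx Y -> fo_idx X)
    (f g : forall j, Arr (X (u j)) (Y j)) :
  (forall j, f j = g j) -> {| fa_idx := u; fa_arr := f |} = {| fa_idx := u; fa_arr := g |}.
Proof.
  intros H; apply functional_extensionality_dep in H; now rewrite H.
Qed.

Lemma fam_cell_congr {X Y W Z : FamOb} {m : FamPro X Y} {n : FamPro W Z}
    {f : FamArr X W} {g : FamArr Y Z} (a : FamCell m n f g)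
    {k l k' l'} (b : elt (fp_span n) k l) (b' : elt (fp_span n) k' l') :
  elt_val b = elt_val b' -> ceq (a _ _ b) (a _ _ b').
Proof.
  destruct b as [b [] []], b' as [b' [] []]; simpl; intros []; apply ceq_refl.
Qed.

Lemma fam_idC_congr {X Y : FamOb} (m : FamPro X Y)
    {i j i' j'} (a : elt (fp_span m) i j) (a' : elt (fp_span m) i' j') :
  elt_val a = elt_val a' -> ceq (idC (m _ _ a)) (idC (m _ _ a')).
Proof.
  destruct a as [a [] []], a' as [a' [] []]; simpl; intros []; apply ceq_refl.
Qed.

Lemma fam_cell_ext_eq {X Y W Z : FamOb} {m : FamPro X Y} {n : FamPro W Z}
    {f : FamArr X W} {g : FamArr Y Z} (a a' : FamCell m n f g) :
  (forall b, fc_map a b = fc_map a' b) ->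
  (forall b : fp_span n, ceq (a _ _ (this b)) (a' _ _ (this b))) -> a = a'.
Proof.
  destruct a as [s a], a' as [s' a']; simpl; intros Hs Ha.
  apply sm_ext in Hs; subst s'; f_equal.
  apply functional_extensionality_dep; intros k.
  apply functional_extensionality_dep; intros l.
  apply functional_extensionality_dep; intros [b [] []].
  exact (ceq_eq (Ha b)).
Qed.

Lemma fam_cell_ext {X Y W Z : FamOb} {m : FamPro X Y} {n : FamPro W Z}
    {f f' : FamArr X W} {g g' : FamArr Y Z} (a : FamCell m n f g) (a' : FamCell m n f' g') :
  f = f' -> g = g' ->
  (forall b, fc_map a b = fc_map a' b) ->
  (forall b : fp_span n, ceq (a _ _ (this b)) (a' _ _ (this b))) ->
  eq_over (FamCell m n) a a'.
Proof.
  intros <- <- Hs Ha; rewrite (fam_cell_ext_eq Hs Ha); apply eq_over_refl.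
Qed.

Lemma fam_comp_idl {X Y : FamOb} (f : FamArr X Y) : fam_comp (fam_idA Y) f = f.
Proof. destruct f; apply fam_arr_ext; intros; apply comp_idl. Qed.

Lemma fam_comp_idr {X Y : FamOb} (f : FamArr X Y) : fam_comp f (fam_idA X) = f.
Proof. destruct f; apply fam_arr_ext; intros; apply comp_idr. Qed.

Lemma fam_comp_idlr {X Y : FamOb} (f : FamArr X Y) :
  fam_comp (fam_idA Y) f = fam_comp f (fam_idA X).
Proof. now rewrite fam_comp_idl, fam_comp_idr. Qed.

Lemma fam_comp_assoc {X Y Z T : FamOb} (h : FamArr Z T) (g : FamArr Y Z) (f : FamArr X Y) :
  fam_comp h (fam_comp g f) = fam_comp (fam_comp h g) f.
Proof. apply fam_arr_ext; intros; apply comp_assoc. Qed.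

Definition fam_idC {X Y : FamOb} (m : FamPro X Y) : FamCell m m (fam_idA X) (fam_idA Y) := {|
  fc_map := (sm_id (fp_span m) : SpanMap _ _ (fa_idx (fam_idA X)) (fa_idx (fam_idA Y)));
  fc_cell := @elt_case _ _ (fp_span m)
    (fun i j a => Cell (m _ _ (sm_elt (sm_id (fp_span m)) a)) (m _ _ a) (idA (X i)) (idA (Y j)))
    (fun a => idC (m _ _ (this a)))
|}.

Definition fam_ccomp {X Y W Z U V : FamOb} {m : FamPro X Y} {n : FamPro W Z} {p : FamPro U V}
    {f : FamArr X W} {g : FamArr Y Z} {h : FamArr W U} {k : FamArr Z V}
    (b : FamCell n p h k) (a : FamCell m n f g) :
    FamCell m p (fam_comp h f) (fam_comp k g) := {|
  fc_map := (sm_comp (fc_map a) (fc_map b)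
              : SpanMap _ _ (fa_idx (fam_comp h f)) (fa_idx (fam_comp k g)));
  fc_cell := @elt_case _ _ (fp_span p)
    (fun i j c => Cell (m _ _ (sm_elt (sm_comp (fc_map a) (fc_map b)) c)) (p _ _ c)
                    (fam_comp h f i) (fam_comp k g j))
    (fun c => b _ _ (this c) ∙ a _ _ (sm_elt (fc_map b) (this c)))
|}.

Definition fam_idP (X : FamOb) : FamPro X X := {|
  fp_span := unit_span (fo_idx X);
  fp_pro := @elt_case _ _ (unit_span (fo_idx X)) (fun i j _ => Pro (X i) (X j))
    (fun i => idP (X i))
|}.

Definition fam_idPC {X Y : FamOb} (f : FamArr X Y) : FamCell (fam_idP X) (fam_idP Y) f f := {|
  fc_map := (sm_unit (fa_idx f) : SpanMap (fp_span (fam_idP Y)) (fp_span (fam_idP X)) _ _);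
  fc_cell := @elt_case _ _ (unit_span (fo_idx Y))
    (fun i j b => Cell (fam_idP X _ _ (sm_elt (sm_unit (fa_idx f)) b)) (fam_idP Y _ _ b)
                    (f i) (f j))
    (fun i => idPC (f i))
|}.

Definition fam_odot {X Y Z : FamOb} (m : FamPro X Y) (n : FamPro Y Z) : FamPro X Z := {|
  fp_span := comp_span (fp_span m) (fp_span n);
  fp_pro := fun i k c => m _ _ (elt_fst c) ⊙ n _ _ (elt_snd c)
|}.

Lemma fam_odot_eq {X Y Z : FamOb} (m : FamPro X Y) (n : FamPro Y Z) {i j k}
    {a : elt (fp_span m) i j} {b : elt (fp_span n) j k} {c : elt (fp_span (fam_odot m n)) i k} :
  elt_val a = pb_fst (elt_val c) -> elt_val b = pb_snd (elt_val c) ->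
  m _ _ a ⊙ n _ _ b = fam_odot m n _ _ c.
Proof.
  destruct a as [a p q], b as [b p' q'], c as [[a' b' e] s t]; simpl.
  intros <- <-; simpl in *; subst j.
  unfold elt_fst, elt_snd; simpl.
  now rewrite (proof_irrelevance _ s p), (proof_irrelevance _ t q'),
    (proof_irrelevance _ (eq_sym e) p').
Qed.

Definition fam_codot {X Y Z X' Y' Z' : FamOb} {m : FamPro X Y} {n : FamPro Y Z}
    {m' : FamPro X' Y'} {n' : FamPro Y' Z'} {f : FamArr X X'} {g : FamArr Y Y'} {h : FamArr Z Z'}
    (a : FamCell m m' f g) (b : FamCell n n' g h) :
    FamCell (fam_odot m n) (fam_odot m' n') f h := {|
  fc_map := (sm_odot (fc_map a) (fc_map b)
             : SpanMap (fp_span (fam_odot m' n')) (fp_span (fam_odot m n)) _ _);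
  fc_cell := fun i k (c : elt (fp_span (fam_odot m' n')) i k) =>
    cast_src
      (fam_odot_eq (a := sm_elt (fc_map a) (elt_fst c)) (b := sm_elt (fc_map b) (elt_snd c))
         (c := sm_elt (sm_odot (fc_map a) (fc_map b)) c) eq_refl eq_refl)
      (a _ _ (elt_fst c) ⊛ b _ _ (elt_snd c))
|}.

(** A cell over identities whose component at each element of the target span is
    given. *)
Definition fam_glob {X Y : FamOb} (m n : FamPro X Y)
    (s : SpanMap (fp_span n) (fp_span m) (fun i => i) (fun j => j))
    (u : forall b : fp_span n, Cell (m _ _ (sm_elt s (this b))) (n _ _ (this b)) (idA _) (idA _)) :
    FamCell m n (fam_idA X) (fam_idA Y) := {|
  fc_map := (s : SpanMap _ _ (fa_idx (fam_idA X)) (fa_idx (fam_idA Y)));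
  fc_cell := @elt_case _ _ (fp_span n)
    (fun i j b => Cell (m _ _ (sm_elt s b)) (n _ _ b) (idA (X i)) (idA (Y j))) u
|}.

Definition fam_assoc {X Y Z T : FamOb} (m : FamPro X Y) (n : FamPro Y Z) (p : FamPro Z T) :
    FamCell (fam_odot (fam_odot m n) p) (fam_odot m (fam_odot n p)) (fam_idA X) (fam_idA T) :=
  fam_glob (m := fam_odot (fam_odot m n) p) (n := fam_odot m (fam_odot n p))
    (s := sm_assoc (fp_span m) (fp_span n) (fp_span p))
    (fun d => assoc (m _ _ (elt_fst (this d))) (n _ _ (elt_fst (elt_snd (this d))))
                (p _ _ (elt_snd (elt_snd (this d))))).

Definition fam_assoc_inv {X Y Z T : FamOb} (m : FamPro X Y) (n : FamPro Y Z) (p : FamPro Z T) :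
    FamCell (fam_odot m (fam_odot n p)) (fam_odot (fam_odot m n) p) (fam_idA X) (fam_idA T) :=
  fam_glob (m := fam_odot m (fam_odot n p)) (n := fam_odot (fam_odot m n) p)
    (s := sm_assoc_inv (fp_span m) (fp_span n) (fp_span p))
    (fun d => assoc_inv (m _ _ (elt_fst (elt_fst (this d)))) (n _ _ (elt_snd (elt_fst (this d))))
                (p _ _ (elt_snd (this d)))).

Definition fam_lunit {X Y : FamOb} (m : FamPro X Y) :
    FamCell (fam_odot (fam_idP X) m) m (fam_idA X) (fam_idA Y) :=
  fam_glob (m := fam_odot (fam_idP X) m) (n := m) (s := sm_lunit (fp_span m))
    (fun a => lunit (m _ _ (this a))).

Definition fam_lunit_inv {X Y : FamOb} (m : FamPro X Y) :
    FamCell m (fam_odot (fam_idP X) m) (fam_idA X) (fam_idA Y) :=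
  fam_glob (m := m) (n := fam_odot (fam_idP X) m) (s := sm_lunit_inv (fp_span m))
    (fun c => lunit_inv (m _ _ (elt_snd (this c)))).

Definition fam_runit {X Y : FamOb} (m : FamPro X Y) :
    FamCell (fam_odot m (fam_idP Y)) m (fam_idA X) (fam_idA Y) :=
  fam_glob (m := fam_odot m (fam_idP Y)) (n := m) (s := sm_runit (fp_span m))
    (fun a => runit (m _ _ (this a))).

Definition fam_runit_inv {X Y : FamOb} (m : FamPro X Y) :
    FamCell m (fam_odot m (fam_idP Y)) (fam_idA X) (fam_idA Y) :=
  let P := fun c : fp_span (fam_odot m (fam_idP Y)) =>
    Cell (m _ _ (sm_elt (sm_runit_inv (fp_span m)) (this c)))
         (fam_odot m (fam_idP Y) _ _ (this c)) (idA _) (idA _) in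
  fam_glob (m := m) (n := fam_odot m (fam_idP Y)) (s := sm_runit_inv (fp_span m))
    (fun c : pullback_apex (fp_span m) (unit_span (fo_idx Y)) =>
       match c as c0 return P c0 with
       | Pb a j e =>
           match e as e0 in _ = j0 return P (Pb (B := unit_span _) a j0 e0) with
           | eq_refl => runit_inv (m _ _ (this a))
           end
       end).

Lemma fam_idC_at {X Y : FamOb} (m : FamPro X Y) {i j} (a : elt (fp_span m) i j) :
  ceq (fam_idC m _ _ a) (idC (m _ _ a)).
Proof. destruct a as [a [] []]; apply ceq_refl. Qed.

Lemma fam_ccomp_at {X Y W Z U V : FamOb} {m : FamPro X Y} {n : FamPro W Z} {p : FamPro U V}
    {f : FamArr X W} {g : FamArr Y Z} {h : FamArr W U} {k : FamArr Z V}
    (b : FamCell n p h k) (a : FamCell m n f g) {i j} (c : elt (fp_span p) i j) :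
  ceq (fam_ccomp b a _ _ c) (b _ _ c ∙ a _ _ (sm_elt (fc_map b) c)).
Proof. destruct c as [c [] []]; apply ceq_refl. Qed.

Lemma fam_codot_at {X Y Z X' Y' Z' : FamOb} {m : FamPro X Y} {n : FamPro Y Z}
    {m' : FamPro X' Y'} {n' : FamPro Y' Z'} {f : FamArr X X'} {g : FamArr Y Y'} {h : FamArr Z Z'}
    (a : FamCell m m' f g) (b : FamCell n n' g h) {i j}
    (c : elt (fp_span (fam_odot m' n')) i j) :
  ceq (fam_codot a b _ _ c) (a _ _ (elt_fst c) ⊛ b _ _ (elt_snd c)).
Proof. apply cast_src_ceq. Qed.

Lemma fam_assoc_at {X Y Z T : FamOb} (m : FamPro X Y) (n : FamPro Y Z) (p : FamPro Z T)
    {i l} (d : elt (fp_span (fam_odot m (fam_odot n p))) i l)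
    {i' j' k' l'} (a : elt (fp_span m) i' j') (b : elt (fp_span n) j' k')
    (c : elt (fp_span p) k' l') :
  elt_val a = pb_fst (elt_val d) -> elt_val b = pb_fst (pb_snd (elt_val d)) ->
  elt_val c = pb_snd (pb_snd (elt_val d)) ->
  ceq (fam_assoc m n p _ _ d) (assoc (m _ _ a) (n _ _ b) (p _ _ c)).
Proof.
  destruct d as [[a' [b' c' e'] e] [] []], a as [a pa qa], b as [b p1 qb], c as [c p2 qc].
  simpl in *; intros -> -> ->; destruct pa, qa, qb, qc; simpl in *.
  rewrite (proof_irrelevance _ p1 (eq_sym e)), (proof_irrelevance _ p2 (eq_sym e')).
  apply ceq_refl.
Qed.

Lemma fam_assoc_inv_at {X Y Z T : FamOb} (m : FamPro X Y) (n : FamPro Y Z) (p : FamPro Z T)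
    {i l} (d : elt (fp_span (fam_odot (fam_odot m n) p)) i l)
    {i' j' k' l'} (a : elt (fp_span m) i' j') (b : elt (fp_span n) j' k')
    (c : elt (fp_span p) k' l') :
  elt_val a = pb_fst (pb_fst (elt_val d)) -> elt_val b = pb_snd (pb_fst (elt_val d)) ->
  elt_val c = pb_snd (elt_val d) ->
  ceq (fam_assoc_inv m n p _ _ d) (assoc_inv (m _ _ a) (n _ _ b) (p _ _ c)).
Proof.
  destruct d as [[[a' b' e] c' e'] [] []], a as [a pa qa], b as [b p1 qb], c as [c p2 qc].
  simpl in *; intros -> -> ->; destruct pa, qa, qb, qc; simpl in *.
  rewrite (proof_irrelevance _ p1 (eq_sym e)), (proof_irrelevance _ p2 (eq_sym e')).
  apply ceq_refl.
Qed.

Lemma fam_lunit_at {X Y : FamOb} (m : FamPro X Y) {i j i' j'}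
    (a : elt (fp_span m) i j) (a' : elt (fp_span m) i' j') :
  elt_val a = elt_val a' -> ceq (fam_lunit m _ _ a) (lunit (m _ _ a')).
Proof.
  destruct a as [a [] []], a' as [a' [] []]; simpl; intros []; apply ceq_refl.
Qed.

Lemma fam_runit_at {X Y : FamOb} (m : FamPro X Y) {i j i' j'}
    (a : elt (fp_span m) i j) (a' : elt (fp_span m) i' j') :
  elt_val a = elt_val a' -> ceq (fam_runit m _ _ a) (runit (m _ _ a')).
Proof.
  destruct a as [a [] []], a' as [a' [] []]; simpl; intros []; apply ceq_refl.
Qed.

Lemma fam_lunit_inv_at {X Y : FamOb} (m : FamPro X Y) {i j i' j'}
    (c : elt (fp_span (fam_odot (fam_idP X) m)) i j) (a : elt (fp_span m) i' j') :
  pb_snd (elt_val c) = elt_val a -> ceq (fam_lunit_inv m _ _ c) (lunit_inv (m _ _ a)).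
Proof.
  destruct c as [c [] []], a as [a [] []]; destruct c as [c] using lunit_span_case.
  simpl; intros []; apply ceq_refl.
Qed.

Lemma fam_runit_inv_at {X Y : FamOb} (m : FamPro X Y) {i j i' j'}
    (c : elt (fp_span (fam_odot m (fam_idP Y))) i j) (a : elt (fp_span m) i' j') :
  pb_fst (elt_val c) = elt_val a -> ceq (fam_runit_inv m _ _ c) (runit_inv (m _ _ a)).
Proof.
  destruct c as [[c k e] [] []], a as [a [] []]; simpl in *; intros [].
  destruct e; apply ceq_refl.
Qed.

Lemma fam_idPC_at {X Y : FamOb} (f : FamArr X Y) {i j}
    (a : elt (fp_span (fam_idP Y)) i j) k :
  elt_val a = k -> ceq (fam_idPC f _ _ a) (idPC (f k)).
Proof. destruct a as [a [] []]; simpl; intros []; apply ceq_refl. Qed.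

Program Definition Fam : DoubleCategory := {|
  Ob := FamOb;
  Arr := FamArr;
  idA := fam_idA;
  comp := @fam_comp;
  Pro := FamPro;
  Cell := @FamCell;
  idC := @fam_idC;
  ccomp := @fam_ccomp;
  idP := fam_idP;
  idPC := @fam_idPC;
  odot := @fam_odot;
  codot := @fam_codot;
  assoc := @fam_assoc;
  assoc_inv := @fam_assoc_inv;
  lunit := @fam_lunit;
  lunit_inv := @fam_lunit_inv;
  runit := @fam_runit;
  runit_inv := @fam_runit_inv
|}.
Next Obligation. apply fam_comp_idl. Qed.
Next Obligation. apply fam_comp_idr. Qed.
Next Obligation. apply fam_comp_assoc. Qed.
Next Obligation.
  apply fam_cell_ext; try apply fam_comp_idl; try reflexivity.
  intros b; cstep (fam_ccomp_at _ _ _).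
  cstep (over_ceq (ccomp_idl _)).
  now apply fam_cell_congr.
Qed.
Next Obligation.
  apply fam_cell_ext; try apply fam_comp_idr; try reflexivity.
  intros b; cstep (fam_ccomp_at _ _ _).
  cstep (ceq_comp (ceq_refl _) (fam_idC_at _)).
  apply over_ceq, ccomp_idr.
Qed.
Next Obligation.
  apply fam_cell_ext; try apply fam_comp_assoc; try reflexivity.
  intros d; cstep (fam_ccomp_at _ _ _).
  cstep (ceq_comp (ceq_refl _) (fam_ccomp_at _ _ _)).
  cstep (over_ceq (ccomp_assoc _ _ _)).
  apply ceq_sym; cstep (fam_ccomp_at _ _ _).
  apply ceq_comp; [apply fam_ccomp_at|].
  now apply fam_cell_congr.
Qed.
Next Obligation.
  apply fam_cell_ext_eq; [reflexivity|].
  intros i; apply eq_ceq, idPC_id.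
Qed.
Next Obligation.
  apply fam_cell_ext_eq; [reflexivity|].
  intros i; apply eq_ceq, idPC_comp.
Qed.
Next Obligation.
  apply fam_cell_ext_eq; [intros b; now apply pb_ext|].
  intros c; cstep (fam_codot_at _ _ _).
  cstep (ceq_odot (fam_idC_at _) (fam_idC_at _)).
  apply eq_ceq, codot_id.
Qed.
Next Obligation.
  apply fam_cell_ext_eq; [intros d; now apply pb_ext|].
  intros d; cstep (fam_codot_at _ _ _).
  cstep (ceq_odot (fam_ccomp_at _ _ _) (fam_ccomp_at _ _ _)).
  rewrite codot_comp.
  apply ceq_sym; cstep (fam_ccomp_at _ _ _).
  refine (ceq_comp (fam_codot_at a' b' (this d)) _).
  cstep (fam_codot_at a b _).
  apply ceq_odot; now apply fam_cell_congr.
Qed.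
Next Obligation.
  apply fam_cell_ext; try apply fam_comp_idl; [intros d; now repeat apply pb_ext|].
  intros d; cstep (fam_ccomp_at _ _ _).
  cstep (ceq_comp (ceq_refl _) (fam_assoc_at
    (d := sm_elt (fc_map (fam_assoc_inv m n p)) (this d)) (a := elt_fst (elt_fst (this d)))
    (b := elt_snd (elt_fst (this d))) (c := elt_snd (this d)) _ _ _)).
  apply over_ceq, assocK.
Qed.
Next Obligation.
  apply fam_cell_ext; try apply fam_comp_idl; [intros d; now repeat apply pb_ext|].
  intros d; cstep (fam_ccomp_at _ _ _).
  cstep (ceq_comp (ceq_refl _) (fam_assoc_inv_at
    (d := sm_elt (fc_map (fam_assoc m n p)) (this d)) (a := elt_fst (this d))
    (b := elt_fst (elt_snd (this d))) (c := elt_snd (elt_snd (this d))) _ _ _)).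
  apply over_ceq, assoc_invK.
Qed.
Next Obligation.
  apply fam_cell_ext;
    try apply fam_comp_idlr;
    [intros d; now repeat apply pb_ext|].
  intros d; cstep (fam_ccomp_at _ _ _).
  cstep (ceq_comp (ceq_refl _) (fam_codot_at _ _ _)).
  cstep (ceq_comp (ceq_refl _) (ceq_odot (fam_codot_at _ _ _) (ceq_refl _))).
  cstep (ceq_comp (fam_assoc_at (a := elt_fst (this d))
    (b := elt_fst (elt_snd (this d))) (c := elt_snd (elt_snd (this d))) _ _ _)
    (ceq_odot (ceq_odot (ceq_refl _) (ceq_refl _)) (ceq_refl _))).
  cstep (over_ceq (assoc_nat _ _ _)).
  apply ceq_sym; cstep (fam_ccomp_at _ _ _).
  apply ceq_comp.
  - cstep (fam_codot_at _ _ _).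
    apply ceq_odot; [apply ceq_refl | exact (fam_codot_at b c (elt_snd (this d)))].
  - now apply fam_assoc_at.
Qed.
Next Obligation.
  apply fam_cell_ext; try apply fam_comp_idl.
  { intros [i a e]; now apply pb_ext. }
  intros c; destruct c as [a] using lunit_span_case.
  apply over_ceq, lunitK.
Qed.
Next Obligation.
  apply fam_cell_ext; try apply fam_comp_idl; [reflexivity|].
  intros a; cstep (fam_ccomp_at _ _ _).
  cstep (ceq_comp (ceq_refl _) (fam_lunit_inv_at
    (c := sm_elt (fc_map (fam_lunit m)) (this a)) (a := this a) _)).
  apply over_ceq, lunit_invK.
Qed.
Next Obligation.
  apply fam_cell_ext;
    try apply fam_comp_idlr.
  { intros b; apply pb_ext; [symmetry; apply (sm_l (fc_map a)) | reflexivity]. }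
  intros b; cstep (fam_ccomp_at _ _ _).
  cstep (ceq_comp (ceq_refl _) (fam_codot_at _ _ _)).
  cstep (over_ceq (lunit_nat _)).
  apply ceq_sym; cstep (fam_ccomp_at _ _ _).
  apply ceq_comp; [now apply fam_cell_congr|].
  now apply fam_lunit_at.
Qed.
Next Obligation.
  apply fam_cell_ext; try apply fam_comp_idl.
  { intros [a j e]; now apply pb_ext. }
  intros [a j e]; simpl in *; destruct e.
  apply over_ceq, runitK.
Qed.
Next Obligation.
  apply fam_cell_ext; try apply fam_comp_idl; [reflexivity|].
  intros a; cstep (fam_ccomp_at _ _ _).
  cstep (ceq_comp (ceq_refl _) (fam_runit_inv_at
    (c := sm_elt (fc_map (fam_runit m)) (this a)) (a := this a) _)).
  apply over_ceq, runit_invK.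
Qed.
Next Obligation.
  apply fam_cell_ext;
    try apply fam_comp_idlr.
  { intros b; apply pb_ext; [reflexivity | symmetry; apply (sm_r (fc_map a))]. }
  intros b; cstep (fam_ccomp_at _ _ _).
  cstep (ceq_comp (ceq_refl _) (fam_codot_at _ _ _)).
  cstep (over_ceq (runit_nat _)).
  apply ceq_sym; cstep (fam_ccomp_at _ _ _).
  apply ceq_comp; [now apply fam_cell_congr|].
  now apply fam_runit_at.
Qed.
Next Obligation.
  apply fam_cell_ext; [now rewrite !fam_comp_idl | now rewrite !fam_comp_idl
    | intros d; now repeat apply pb_ext |].
  intros [a [b [c d e3] e2] e1]; cstep (fam_ccomp_at _ _ _).
  cstep (over_ceq (pentagon _ _ _ _)).
  apply ceq_sym; cstep (fam_ccomp_at _ _ _).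
  apply ceq_comp.
  - cstep (fam_codot_at _ _ _).
    apply ceq_odot; [apply fam_idC_at |].
    now apply (fam_assoc_at (a := Elt b (eq_sym e1) eq_refl) (b := Elt c (eq_sym e2) eq_refl)
      (c := Elt d (eq_sym e3) eq_refl)).
  - cstep (fam_ccomp_at _ _ _).
    apply ceq_comp.
    + now apply (fam_assoc_at (n := fam_odot n p) (a := this a)
        (b := Elt (A := comp_span (fp_span n) (fp_span p)) (Pb b c e2) (eq_sym e1) eq_refl)
        (c := Elt d (eq_sym e3) eq_refl)).
    + cstep (fam_codot_at _ _ _).
      apply ceq_odot.
      * now apply (fam_assoc_at (a := this a) (b := Elt b (eq_sym e1) eq_refl)
          (c := Elt c (eq_sym e2) eq_refl)).
      * apply (ceq_trans (fam_idC_at _)).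
        now apply (fam_idC_congr (a' := Elt d (eq_sym e3) eq_refl)).
Qed.
Next Obligation.
  apply fam_cell_ext; [now rewrite !fam_comp_idl | now rewrite !fam_comp_idl | |].
  { intros [a b e]; apply pb_ext; [apply pb_ext|]; simpl; congruence. }
  intros [a b e]; cstep (fam_ccomp_at _ _ _).
  apply ceq_sym; cstep (fam_codot_at _ _ _).
  cstep (ceq_odot (ceq_refl _) (fam_idC_at _)).
  cstep (ceq_sym (over_ceq (triangle _ _))).
  apply ceq_sym, ceq_comp.
  - cstep (fam_codot_at _ _ _).
    apply ceq_odot; [apply fam_idC_at | now apply fam_lunit_at].
  - apply (fam_assoc_at (n := fam_idP y) (a := this a)
      (b := Elt (A := unit_span _) (rleg a) eq_refl eq_refl) (c := Elt b (eq_sym e) eq_refl)); simpl; congruence.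
Qed.

End Families.

Arguments fp_span {D X Y} _.
Arguments fp_pro {D X Y} _ {i j} _.
Arguments fc_map {D X Y W Z m n f g} _.
Arguments fc_cell {D X Y W Z m n f g} _ {k l} _.
Arguments fa_arr {D X Y} _ _.

Section Diagonal.
Context (D : DoubleCategory).

Definition delta_ob (x : Ob D) : Ob (Fam D) := {| fo_idx := unit; fo_ob := fun _ => x |}.

Definition delta_arr {x y : Ob D} (f : Arr x y) : Arr (delta_ob x) (delta_ob y) :=
  @Build_FamArr D (delta_ob x) (delta_ob y) (fun i => i) (fun _ => f).

Definition delta_pro {x y : Ob D} (m : Pro x y) : Pro (delta_ob x) (delta_ob y) :=
  @Build_FamPro D (delta_ob x) (delta_ob y) (unit_span unit) (fun _ _ _ => m).

Definition delta_cell {x y w z : Ob D} {m : Pro x y} {n : Pro w z} {f : Arr x w} {g : Arr y z}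
    (a : Cell m n f g) : Cell (delta_pro m) (delta_pro n) (delta_arr f) (delta_arr g) :=
  @Build_FamCell D _ _ _ _ (delta_pro m) (delta_pro n) (delta_arr f) (delta_arr g)
    (sm_id (unit_span unit)) (fun _ _ _ => a).

Definition delta_mu {x y z : Ob D} (m : Pro x y) (n : Pro y z) :
    Cell (delta_pro m ⊙ delta_pro n) (delta_pro (m ⊙ n)) (idA (delta_ob x)) (idA (delta_ob z)) :=
  fam_glob (m := fam_odot (delta_pro m) (delta_pro n)) (n := delta_pro (m ⊙ n))
    (s := sm_lunit (unit_span unit)) (fun _ => idC (m ⊙ n)).

Definition delta_eta (x : Ob D) :
    Cell (idP (delta_ob x)) (delta_pro (idP x)) (idA (delta_ob x)) (idA (delta_ob x)) :=
  fam_glob (m := fam_idP (delta_ob x)) (n := delta_pro (idP x))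
    (s := sm_id (unit_span unit)) (fun _ => idC (idP x)).

Lemma delta_mu_at {x y z : Ob D} (m : Pro x y) (n : Pro y z) {i j}
    (a : elt (unit_span unit) i j) :
  ceq (fc_cell (delta_mu m n) a) (idC (m ⊙ n)).
Proof. destruct a as [a [] []]; apply ceq_refl. Qed.

Lemma delta_eta_at (x : Ob D) {i j} (a : elt (unit_span unit) i j) :
  ceq (fc_cell (delta_eta x) a) (idC (idP x)).
Proof. destruct a as [a [] []]; apply ceq_refl. Qed.

Lemma unit_eq (i j : unit) : i = j.
Proof. now destruct i, j. Qed.

Program Definition Delta : LaxFunctor D (Fam D) := {|
  lf_ob := delta_ob;
  lf_arr := @delta_arr;
  lf_pro := @delta_pro;
  lf_cell := @delta_cell;
  lf_mu := @delta_mu;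
  lf_eta := delta_eta
|}.
Next Obligation.
  apply fam_cell_ext; try reflexivity.
Qed.
Next Obligation.
  apply fam_cell_ext; try reflexivity.
Qed.
Next Obligation.
  apply fam_cell_ext; try apply (eq_sym (fam_comp_idlr _)).
  { intros c; apply pb_ext; apply unit_eq. }
  intros c; cstep (fam_ccomp_at _ _ _).
  cstep (over_ceq (ccomp_idr _)).
  apply ceq_sym; cstep (fam_ccomp_at _ _ _).
  cstep (ceq_comp (ceq_refl _) (fam_codot_at _ _ _)).
  apply over_ceq, ccomp_idl.
Qed.
Next Obligation.
  apply fam_cell_ext; try apply (eq_sym (fam_comp_idlr _)).
  { intros c; apply unit_eq. }
  intros c; cstep (fam_ccomp_at _ _ _).
  cstep (over_ceq (ccomp_idr _)).
  apply ceq_sym; cstep (fam_ccomp_at _ _ _).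
  apply over_ceq, ccomp_idl.
Qed.
Next Obligation.
  apply fam_cell_ext; try now rewrite !fam_comp_idl.
  { intros c; repeat apply pb_ext; apply unit_eq. }
  intros c.
  apply (ceq_trans (b := assoc m n p)).
  - cstep (fam_ccomp_at _ _ _).
    eapply ceq_trans;
      [apply (ceq_comp (b' := assoc m n p) (a' := idC (m ⊙ n ⊙ p))) |].
    + apply ceq_refl.
    + cstep (fam_ccomp_at _ _ _).
      eapply ceq_trans;
        [apply (ceq_comp (b' := idC (m ⊙ n ⊙ p)) (a' := idC (m ⊙ n) ⊛ idC p)) |].
      * apply delta_mu_at.
      * cstep (fam_codot_at _ _ _).
        apply ceq_odot; [apply delta_mu_at | apply fam_idC_at].
      * rewrite codot_id; apply over_ceq, ccomp_idl.
    + apply over_ceq, ccomp_idr.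
  - apply ceq_sym.
    cstep (fam_ccomp_at _ _ _).
    eapply ceq_trans; [apply (ceq_comp (b' := idC (m ⊙ (n ⊙ p)))
      (a' := (idC m ⊛ idC (n ⊙ p)) ∙ assoc m n p)); [apply delta_mu_at|] |].
    + cstep (fam_ccomp_at _ _ _).
      apply ceq_comp.
      * cstep (fam_codot_at _ _ _).
        apply ceq_odot; [apply fam_idC_at | apply delta_mu_at].
      * now apply (fam_assoc_at (m := delta_pro m) (n := delta_pro n) (p := delta_pro p)
          (a := @this _ _ (unit_span unit) tt) (b := @this _ _ (unit_span unit) tt)
          (c := @this _ _ (unit_span unit) tt)); apply unit_eq.
    + rewrite codot_id.
      cstep (over_ceq (ccomp_idl _)).
      apply over_ceq, ccomp_idl.
Qed.
Next Obligation.
  apply fam_cell_ext; try now rewrite !fam_comp_idl.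
  { intros c; repeat apply pb_ext; apply unit_eq. }
  intros c; cstep (fam_ccomp_at _ _ _).
  eapply ceq_trans; [apply (ceq_comp (b' := lunit m) (a' := idC (idP x ⊙ m))) |].
  - apply ceq_refl.
  - cstep (fam_ccomp_at _ _ _).
    eapply ceq_trans;
      [apply (ceq_comp (b' := idC (idP x ⊙ m)) (a' := idC (idP x) ⊛ idC m)) |].
    + apply delta_mu_at.
    + cstep (fam_codot_at _ _ _).
      apply ceq_odot; [apply delta_eta_at | apply fam_idC_at].
    + rewrite codot_id; apply over_ceq, ccomp_idl.
  - cstep (over_ceq (ccomp_idr _)).
    now apply ceq_sym, (fam_lunit_at (m := delta_pro m) (a' := this c)).
Qed.
Next Obligation.
  apply fam_cell_ext; try now rewrite !fam_comp_idl.
  { intros c; repeat apply pb_ext; apply unit_eq. }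
  intros c; cstep (fam_ccomp_at _ _ _).
  eapply ceq_trans; [apply (ceq_comp (b' := runit m) (a' := idC (m ⊙ idP y))) |].
  - apply ceq_refl.
  - cstep (fam_ccomp_at _ _ _).
    eapply ceq_trans;
      [apply (ceq_comp (b' := idC (m ⊙ idP y)) (a' := idC m ⊛ idC (idP y))) |].
    + apply delta_mu_at.
    + cstep (fam_codot_at _ _ _).
      apply ceq_odot; [apply fam_idC_at | apply delta_eta_at].
    + rewrite codot_id; apply over_ceq, ccomp_idl.
  - cstep (over_ceq (ccomp_idr _)).
    now apply ceq_sym, (fam_runit_at (m := delta_pro m) (a' := this c)).
Qed.

End Diagonal.

Record LaxProducts (D : DoubleCategory) := {
  lax_prod :> LaxFunctor (Fam D) D;
  lax_prod_adj : Adjunction (Delta D) lax_prod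
}.

(** The family of chosen restrictions of the members of [n] along the components
    of [f] and [g], indexed by the span [I <- K <- B -> L -> J]. *)
Definition restricted_family {D : DoubleCategory} {X Y W Z : FamOb D}
    {n : FamPro W Z} {f : FamArr X W} {g : FamArr Y Z}
    (r : forall k l (b : elt (fp_span n) k l), Restriction (n k l b) (f k) (g l)) :
    FamPro X Y :=
  let S := extend_span (fa_idx f) (fp_span n) (fa_idx g) in
  @Build_FamPro D X Y S
    (@elt_case _ _ S (fun i j _ => Pro (X i) (Y j))
       (fun b => res_pro (r _ _ (this (A := fp_span n) b)))).

(* Main.v *)
Require Import Defs.
From Stdlib Require Import ClassicalEpsilon.

Set Implicit Arguments.
Unset Strict Implicit.
Unset Printing Implicit Defensive.

(** The restriction cells [n_b(f_k, g_l) -> n_b] are the components of a cell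
    [n(f,g) -> n] of the double category of families, lying over the identity of
    the indexing set [B].  A cell into a family is a reindexing of spans together
    with a family of cells, so it factors through this one by factoring each
    component through the corresponding restriction cell; the reindexing is
    unaffected.  Hence [n(f,g) -> n] is a restriction cell of families
    ([restricted_family_cell_spec]).

    The product [Pi] is a right adjoint, and right adjoints preserve restriction
    cells ([right_adjoint_restriction]).  Indeed, for [F] left adjoint to [G],
    cells [m -> G n] correspond to cells [F m -> n] by [c |-> counit_n ∙ F c]
    and [d |-> G d ∙ unit_m], naturally in [n], so a factorization of [c] through
    [G res] is the same thing as a factorization of its transpose through [res].
    This correspondence is a consequence of the naturality of the unit and counit
    in arrows and cells and of the triangle identities ([transpose_cell_comp],
    [transpose_cellK]).
    Applying [Pi] to the restriction cell of families gives the result. *)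

Section Restrictions.
Context {D : DoubleCategory} {x y w z : Ob D} {p : Pro x y} {n : Pro w z}
  {f : Arr x w} {g : Arr y z} {res : Cell p n f g} (Hres : is_restriction_cell res).

(** Transposing along an adjunction produces sides that are only provably of the
    form [f ∘ h] and [g ∘ k]. *)
Lemma restriction_factor {u v : Ob D} {m : Pro u v} {s : Arr u w} {t : Arr v z}
    (c : Cell m n s t) (h : Arr u x) (k : Arr v y) :
  s = f ∘ h -> t = g ∘ k -> exists a : Cell m p h k, ceq (res ∙ a) c.
Proof.
  intros -> ->.
  destruct (Hres c) as [a [Ha _]].
  exists a; exact (eq_ceq Ha).
Qed.

(** The factors are compared with sources and sides that need only be provably
    equal, because members of a family at the same index can be presented by
    different proofs about its legs. *)
Lemma restriction_cancel {u v : Ob D} {m m' : Pro u v} {h h' : Arr u x} {k k' : Arr v y}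
    (a : Cell m p h k) (a' : Cell m' p h' k') :
  m = m' -> h = h' -> k = k' -> ceq (res ∙ a) (res ∙ a') -> ceq a a'.
Proof.
  intros <- <- <- H.
  destruct (Hres (res ∙ a)) as [a0 [_ Huniq]].
  apply eq_ceq.
  now rewrite <- (Huniq a eq_refl), <- (Huniq a' (eq_sym (ceq_eq H))).
Qed.

End Restrictions.

Section RightAdjoint.
Context {C D : DoubleCategory} {F : LaxFunctor C D} {G : LaxFunctor D C}
  (adj : Adjunction F G).

Notation η := (adj_unit adj).
Notation ε := (adj_counit adj).

Lemma transpose_arr_comp {u : Ob C} {x w : Ob D} (f : Arr x w) (h : Arr u (G x)) :
  nt_arr ε w ∘ lf_arr F (lf_arr G f ∘ h) = f ∘ (nt_arr ε x ∘ lf_arr F h).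
Proof.
  rewrite lf_arr_comp, !comp_assoc.
  f_equal; symmetry; exact (nt_arr_nat ε f).
Qed.

Lemma transpose_arrK {u : Ob C} {x : Ob D} (h : Arr u (G x)) :
  lf_arr G (nt_arr ε x ∘ lf_arr F h) ∘ nt_arr η u = h.
Proof.
  rewrite lf_arr_comp, <- comp_assoc.
  refine (eq_trans (f_equal (fun s => _ ∘ s) (nt_arr_nat η h)) _); simpl.
  rewrite comp_assoc.
  refine (eq_trans (f_equal (fun s => s ∘ h) (adj_right_arr adj x)) _).
  apply comp_idl.
Qed.

(** Transposition is natural in the target: composing with [a] after transposing
    is transposing after composing with [G a]. *)
Lemma transpose_cell_comp {u v : Ob C} {x y w z : Ob D} {m : Pro u v}
    {p : Pro x y} {n : Pro w z} {f : Arr x w} {g : Arr y z} (a : Cell p n f g)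
    {h : Arr u (G x)} {k : Arr v (G y)} (b : Cell m (lf_pro G p) h k) :
  ceq (a ∙ (nt_cell ε p ∙ lf_cell F b))
      (nt_cell ε n ∙ lf_cell F (lf_cell G a ∙ b)).
Proof.
  eapply ceq_trans; [exact (over_ceq (ccomp_assoc _ _ _))|].
  eapply ceq_trans;
    [exact (ceq_comp (over_ceq (nt_cell_nat ε a)) (ceq_refl _))|].
  eapply ceq_trans; [exact (ceq_sym (over_ceq (ccomp_assoc _ _ _)))|].
  exact (ceq_comp (ceq_refl _) (ceq_sym (over_ceq (lf_cell_comp F _ _)))).
Qed.

(** By naturality of the unit at [b] and the triangle identity at [p]. *)
Lemma transpose_cellK {u v : Ob C} {x y : Ob D} {m : Pro u v} {p : Pro x y}
    {h : Arr u (G x)} {k : Arr v (G y)} (b : Cell m (lf_pro G p) h k) :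
  ceq (lf_cell G (nt_cell ε p ∙ lf_cell F b) ∙ nt_cell η m) b.
Proof.
  eapply ceq_trans;
    [exact (ceq_comp (over_ceq (lf_cell_comp G _ _)) (ceq_refl _))|].
  eapply ceq_trans; [exact (ceq_sym (over_ceq (ccomp_assoc _ _ _)))|].
  eapply ceq_trans;
    [exact (ceq_comp (ceq_refl _) (over_ceq (nt_cell_nat η b)))|].
  eapply ceq_trans; [exact (over_ceq (ccomp_assoc _ _ _))|].
  eapply ceq_trans;
    [exact (ceq_comp (over_ceq (adj_right_cell adj p)) (ceq_refl _))|].
  exact (over_ceq (ccomp_idl _)).
Qed.

(** A factorization of [c] through [G res] is the transpose of a factorization of
    the transpose of [c] through [res]. *)
Lemma right_adjoint_restriction {x y w z : Ob D} {p : Pro x y} {n : Pro w z}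
    {f : Arr x w} {g : Arr y z} (res : Cell p n f g) :
  is_restriction_cell res -> is_restriction_cell (lf_cell G res).
Proof.
  intros Hres u v m h k c.
  destruct (restriction_factor Hres (nt_cell ε n ∙ lf_cell F c)
    (transpose_arr_comp f h) (transpose_arr_comp g k)) as [a Ha].
  exists (cast_sides (transpose_arrK h) (transpose_arrK k) (lf_cell G a ∙ nt_cell η m)).
  split.
  - apply ceq_eq.
    eapply ceq_trans; [exact (ceq_comp (ceq_refl _) (cast_sides_ceq _ _ _))|].
    eapply ceq_trans; [exact (over_ceq (ccomp_assoc _ _ _))|].
    eapply ceq_trans;
      [exact (ceq_comp (ceq_sym (over_ceq (lf_cell_comp G res a))) (ceq_refl _))|].
    eapply ceq_trans; [exact (ceq_comp (lf_ceq G Ha) (ceq_refl _))|].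
    apply transpose_cellK.
  - intros b Hb; apply ceq_eq.
    eapply ceq_trans; [apply cast_sides_ceq|].
    eapply ceq_trans; [|exact (transpose_cellK b)].
    refine (ceq_comp (lf_ceq G _) (ceq_refl _)).
    apply (restriction_cancel Hres); try reflexivity.
    eapply ceq_trans; [exact Ha|].
    apply ceq_sym; rewrite <- Hb; apply transpose_cell_comp.
Qed.

End RightAdjoint.

Section FamilyRestriction.
Context {D : DoubleCategory} {X Y W Z : FamOb D} {n : FamPro W Z}
  {f : FamArr X W} {g : FamArr Y Z}
  (r : forall k l (b : elt (fp_span n) k l), Restriction (fp_pro n b) (fa_arr f k) (fa_arr g l)).

Definition extend_map {I J K L : Type} (i : K -> I) (B : Span K L) (j : L -> J) :
    SpanMap B (extend_span i B j) i j :=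
  @Build_SpanMap _ _ _ _ B (extend_span i B j) i j
    (fun b => b) (fun _ => eq_refl) (fun _ => eq_refl).

Definition restricted_family_cell : FamCell (restricted_family r) n f g :=
  @Build_FamCell D _ _ _ _ (restricted_family r) n f g
    (extend_map (fa_idx f) (fp_span n) (fa_idx g))
    (@elt_case _ _ (fp_span n)
      (fun k l b => Cell (fp_pro (restricted_family r)
                            (sm_elt (extend_map (fa_idx f) (fp_span n) (fa_idx g)) b))
                      (fp_pro n b) (fa_arr f k) (fa_arr g l))
      (fun b => res_cell (r (this b)))).

Section Factor.
Context {U V : FamOb D} {m : FamPro U V} {h : FamArr U X} {k : FamArr V Y}
  (c : FamCell m n (fam_comp f h) (fam_comp g k)).

Definition restricted_factor_map :
    SpanMap (fp_span (restricted_family r)) (fp_span m) (fa_idx h) (fa_idx k) :=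
  @Build_SpanMap _ _ _ _ (fp_span (restricted_family r)) (fp_span m) (fa_idx h) (fa_idx k)
    (fun b => fc_map c b) (sm_l (fc_map c)) (sm_r (fc_map c)).

Lemma restricted_factor_exists (b : fp_span n) :
  exists a : Cell (fp_pro m (sm_elt (fc_map c) (this b))) (res_pro (r (this b)))
               (fa_arr h (fa_idx f (lleg b))) (fa_arr k (fa_idx g (rleg b))),
    ceq (res_cell (r (this b)) ∙ a) (fc_cell c (this b)).
Proof. now apply (restriction_factor (res_cell_spec (r (this b)))). Qed.

(** The components are chosen from existence statements; being unique, they do
    not depend on the choice. *)
Definition restricted_factor : FamCell m (restricted_family r) h k :=
  @Build_FamCell D _ _ _ _ m (restricted_family r) h k restricted_factor_map
    (@elt_case _ _ (fp_span (restricted_family r))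
      (fun i j b => Cell (fp_pro m (sm_elt restricted_factor_map b))
                      (fp_pro (restricted_family r) b) (fa_arr h i) (fa_arr k j))
      (fun b => proj1_sig (constructive_indefinite_description _
                             (restricted_factor_exists b)))).

Lemma restricted_factorP (b : fp_span n) :
  ceq (res_cell (r (this b)) ∙
         fc_cell restricted_factor (this (A := fp_span (restricted_family r)) b))
      (fc_cell c (this b)).
Proof.
  exact (proj2_sig (constructive_indefinite_description _ (restricted_factor_exists b))).
Qed.

End Factor.

Lemma restricted_family_cell_spec :
  @is_restriction_cell (Fam D) _ _ _ _ _ _ _ _ restricted_family_cell.
Proof.
  intros U V m h k c.
  exists (restricted_factor c); split.
  - apply fam_cell_ext_eq; [reflexivity|].
    intros b; exact (restricted_factorP c b).
  - intros a <-.
    apply fam_cell_ext_eq; [reflexivity|].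
    intros b; refine (restriction_cancel (res_cell_spec (r (this (A := fp_span n) b)))
      _ eq_refl eq_refl _).
    + (* The two sources are the members of [m] at the same index, seen over its
         legs by different proofs. *)
      f_equal; now apply elt_eq.
    + refine (ceq_trans (restricted_factorP _ b) _).
      refine (ceq_trans (fam_ccomp_at _ _ _) (ceq_comp (ceq_refl _) _)).
      now apply fam_cell_congr.
Qed.

End FamilyRestriction.

Theorem proposition8p5 (D : DoubleCategory) (Pi : LaxProducts D)
  (Ix Jy Kw Lz : Ob (Fam D))
  (Bn : Pro Kw Lz) (f : Arr Ix Kw) (g : Arr Jy Lz)
  (r : forall k l (b : elt (fp_span Bn) k l), Restriction (fp_pro Bn b) (fa_arr f k) (fa_arr g l)) :
  exists res : Cell (lf_pro Pi (restricted_family r)) (lf_pro Pi Bn) (lf_arr Pi f) (lf_arr Pi g),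
    is_restriction_cell res.
Proof.
  exists (@lf_cell _ _ Pi _ _ _ _ _ _ _ _ (restricted_family_cell r)).
  exact (right_adjoint_restriction (lax_prod_adj Pi) (restricted_family_cell_spec r)).
Qed.
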